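(* The functor $\mathcal{T}:\mathbf{SMBLaw}\to\mathbf{ACMnd}$, $\mathbf{L}\mapsto T_{\mathbf L}$, restricts to a functor $\mathbf{DSMBLaw}\to\mathbf{IACMnd}$, and yields a left adjoint to $\mathcal{K}\ell_{\mathbb N}:\mathbf{IACMnd}\to\mathbf{DSMBLaw}$.
   Context: Monads on $\mathbf{Sets}$. Each monad $T$ on $\mathbf{Sets}$ has strength $\mathsf{st}:T(X)\times Y\to T(X\times Y)$, $\mathsf{st}(u,y)=T(\lambda x.(x,y))(u)$; let $\mathsf{st}'=T(\gamma)\circ\mathsf{st}\circ\gamma$ with $\gamma$ the swap. $T$ is commutative if $\mu\circ T(\mathsf{st}')\circ\mathsf{st}=\mu\circ T(\mathsf{st})\circ\mathsf{st}'$; this map is then $\mathsf{dst}:T(X)\times T(Y)\to T(X\times Y)$. If $T(0)\cong1$, let $0_{X,Y}=(X\to1\cong T(0)\xrightarrow{T(!)}T(Y))$, $p_1=[\eta,0_{Y,X}]$, $p_2=[0_{X,Y},\eta]$, $\mathsf{bc}=\langle\mu\circ T(p_1),\mu\circ T(p_2)\rangle:T(X+Y)\to T(X)\times T(Y)$. $T$ is additive if $T(0)\cong1$ and all $\mathsf{bc}$ are isomorphisms. $\mathbf{ACMnd}$: additive commutative monads on $\mathbf{Sets}$ with monad maps. $\mathbf{IACMnd}$: pairs $(T,\zeta)$ with $T\in\mathbf{ACMnd}$ and $\zeta:T\to T$ a monad map with $\zeta\circ\zeta=\mathrm{id}$; morphisms are monad maps $\sigma$ with $\sigma\circ\zeta=\zeta'\circ\sigma$.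 Lawvere theories. Let $\underline{n}=\{0,\ldots,n-1\}$. $\aleph_0$ has natural numbers as objects and functions $\underline n\to\underline m$ as morphisms; $(+,0)$ gives finite coproducts. A Lawvere theory is a small category $\mathbf{L}$ with natural numbers as objects together with a functor $\aleph_0\to\mathbf{L}$ that is the identity on objects and strictly preserves finite coproducts; morphisms are identity-on-objects functors strictly preserving finite coproducts. $\aleph_0$ has a symmetric monoidal structure: $n\otimes m=n\times m$ (multiplication), unit $1$, $f\otimes g=\mathsf{co}^{-1}\circ(f\times g)\circ\mathsf{co}$ where $\mathsf{co}:\underline{n\times m}\to\underline n\times\underline m$ is the bijection with $\mathsf{co}(c)=(a,b)\iff c=a\cdot m+b$, and the monoidal isomorphisms are transported from $(\mathbf{Sets},\times,1)$ along $\mathsf{co}$. $\mathbf{SMBLaw}$: Lawvere theories $\mathbf{L}$ with a symmetric monoidal structure strictly preserved by $\aleph_0\to\mathbf{L}$, in which $(+,0)$ forms biproducts ($0$ is a zero object and each $n+m$ is also a product with projections satisfying $\pi_j\circ\kappa_i=\mathrm{id}$ if $i=j$, and the zero map if $i\ne j$); morphisms are identity-on-objects functors strictly preserving all the structure. $\mathbf{DSMBLaw}$: objects are $\mathbf{L}\in\mathbf{SMBLaw}$ with a dagger, i.e. an identity-on-objects functor $\dagger:\mathbf{L}^{\mathrm{op}}\to\mathbf{L}$ with $(f^\dagger)^\dagger=f$, such that $(f\otimes g)^\dagger=f^\dagger\otimes g^\dagger$, the coherence isomorphisms $\alpha,\rho,\gamma$ satisfy $f^{-1}=f^\dagger$,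 and $\kappa_i=\pi_i^\dagger$; morphisms are those of $\mathbf{SMBLaw}$ strictly commuting with daggers. Functor $\mathcal{K}\ell_{\mathbb N}$: $\mathcal{K}\ell_{\mathbb{N}}(T)$ has natural numbers as objects, functions $\underline n\to T(\underline m)$ as morphisms $n\to m$, Kleisli composition, (bi)products given by $+$ from $\mathbf{Sets}$, and tensor $T(\mathsf{co}^{-1})\circ\mathsf{dst}\circ(f\times g)\circ\mathsf{co}$; a monad map $\sigma$ acts by $f\mapsto\sigma\circ f$. Let $\mathsf{bc}_m:T(\underline m)\to T(1)^m$ be the $m$-fold version of $\mathsf{bc}$, an isomorphism. A morphism $g:n\to m$ corresponds to the matrix $\theta(g):\underline n\times\underline m\to T(1)$, $\theta(g)(i,j)=\pi_j(\mathsf{bc}_m(g(i)))$, and this is a bijection. For $(T,\zeta)\in\mathbf{IACMnd}$ the dagger on $\mathcal{K}\ell_{\mathbb N}(T)$ is determined by $\theta(g^\dagger)(j,i)=\zeta_1(\theta(g)(i,j))$. Functor $\mathcal{T}$: $T_{\mathbf L}(X)=\big(\coprod_{i\in\mathbb N}\mathbf{L}(1,i)\times X^i\big)/\!\sim$, with $\sim$ the least equivalence relation such that $\kappa_m(f\circ g,v)\sim\kappa_i(g,v\circ f)$ for $f:i\to m$ in $\aleph_0$, $g\in\mathbf{L}(1,i)$, $v\in X^m$. $T_{\mathbf L}(h)[\kappa_i(g,v)]=[\kappa_i(g,h\circ v)]$; unit $x\mapsto[\kappa_1(\mathrm{id}_1,x)]$; multiplication $\mu([\kappa_i(g,v)])=[\kappa_j((g_0+\cdots+g_{i-1})\circ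 g,[v_0,\ldots,v_{i-1}])]$, where $v(a)=[\kappa_{j_a}(g_a,v_a)]$ for $a<i$ and $j=j_0+\cdots+j_{i-1}$. A morphism $F$ is sent to $[\kappa_i(g,v)]\mapsto[\kappa_i(F(g),v)]$. For $\mathbf{L}\in\mathbf{DSMBLaw}$, $T_{\mathbf L}$ is equipped with $\zeta_X([\kappa_i(g,v)])=[\kappa_i(\langle g_0^\dagger,\ldots,g_{i-1}^\dagger\rangle,v)]$, where $g=\langle g_0,\ldots,g_{i-1}\rangle:1\to i=1+\cdots+1$ is decomposed using that $i$ is an $i$-fold product of $1$. *)

(* Defs.v *)
From Stdlib Require Import Relations.
From mathcomp Require Import all_boot all_order generic_quotient.
From mathcomp Require Import boolp classical_sets.

Set Implicit Arguments.
Unset Strict Implicit.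
Unset Printing Implicit Defensive.

Local Open Scope quotient_scope.

(* One fixed universe: monads, Lawvere theories and their hom-sets all refer to
   the same category of sets. *)
Definition Sets := Type.

Lemma sval_eq (A : Type) (P : A -> Prop) (s t : {x | P x}) :
  sval s = sval t -> s = t.
Proof. by case: s t => [s sP] [t tP] /=; apply: eq_exist. Qed.

Record category := Category {
  ob :> Type;
  hom : ob -> ob -> Type;
  idc : forall a, hom a a;
  compc : forall a b c, hom b c -> hom a b -> hom a c;
  compc1 : forall a b (f : hom a b), compc f (idc a) = f;
  comp1c : forall a b (f : hom a b), compc (idc b) f = f;
  compcA : forall a b c d (h : hom c d) (g : hom b c) (f : hom a b),
    compc h (compc g f) = compc (compc h g) f }.

Arguments idc {_} _.
Arguments compc {_ _ _ _} _ _.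

(* The object part is a parameter, so that the arrow parts of functors with a
   prescribed object part can be compared without casts. *)
Record functor (C D : category) (F0 : C -> D) := Functor {
  fmap :> forall a b : C, hom a b -> hom (F0 a) (F0 b);
  fmap1 : forall a : C, fmap (idc a) = idc (F0 a);
  fmapM : forall (a b c : C) (g : hom b c) (f : hom a b),
    fmap (compc g f) = compc (fmap g) (fmap f) }.

Arguments fmap {C D F0} _ {a b} _.

Definition left_adjoint (C D : category) (F0 : C -> D) (G0 : D -> C)
    (F : functor F0) (G : functor G0) : Prop :=
  exists phi : forall (c : C) (d : D), hom (F0 c) d -> hom c (G0 d),
    [/\ forall (c : C) (d : D), bijective (@phi c d),
        forall (c c' : C) (d : D) (h : hom c' c) (f : hom (F0 c) d),
          phi c' d (compc f (fmap F h)) = compc (phi c d f) h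
      & forall (c : C) (d d' : D) (k : hom d d') (f : hom (F0 c) d),
          phi c d' (compc k f) = compc (fmap G k) (phi c d f)].

Record monad_ops (T : Sets -> Sets) := MonadOps {
  mmap : forall X Y : Sets, (X -> Y) -> T X -> T Y;
  meta : forall X : Sets, X -> T X;
  mmu : forall X : Sets, T (T X) -> T X }.

Arguments mmap {T} _ {X Y} _ _.
Arguments meta {T} _ {X} _.
Arguments mmu {T} _ {X} _.

Definition swap (X Y : Sets) (p : X * Y) : Y * X := (p.2, p.1).

Section MonadNotions.
Variables (T : Sets -> Sets) (M : monad_ops T).
Implicit Types X Y Z : Sets.

Record is_monad : Prop := IsMonad {
  mmap_id : forall X, mmap M (@id X) =1 id;
  mmap_comp : forall X Y Z (g : Y -> Z) (f : X -> Y),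
    mmap M (g \o f) =1 mmap M g \o mmap M f;
  meta_nat : forall X Y (f : X -> Y), meta M \o f =1 mmap M f \o meta M;
  mmu_nat : forall X Y (f : X -> Y),
    mmu M \o mmap M (mmap M f) =1 mmap M f \o mmu M;
  mmu_eta : forall X, mmu M \o meta M =1 @id (T X);
  mmu_map_eta : forall X, mmu M \o mmap M (meta M) =1 @id (T X);
  mmu_mu : forall X,
    mmu M \o mmap M (mmu M) =1 mmu M \o mmu M :> (T (T (T X)) -> T X) }.

Definition st X Y (p : T X * Y) : T (X * Y)%type :=
  mmap M (fun x => (x, p.2)) p.1.

Definition st' X Y : X * T Y -> T (X * Y)%type :=
  mmap M (@swap Y X) \o @st Y X \o @swap X (T Y).

Definition dst X Y : T X * T Y -> T (X * Y)%type :=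
  mmu M \o mmap M (@st' X Y) \o @st X (T Y).

Definition is_commutative : Prop :=
  forall X Y, @dst X Y =1 mmu M \o mmap M (@st X Y) \o @st' (T X) Y.

(* [i] stands for the isomorphism from 1 to T(0). *)
Definition zmap (i : unit -> T void) X Y (_ : X) : T Y :=
  mmap M (of_void Y) (i tt).

Definition bc (i : unit -> T void) X Y (t : T (X + Y)%type) : T X * T Y :=
  (mmu M (mmap M (fun u => match u with
                           | inl x => meta M x
                           | inr y => zmap i X y
                           end) t),
   mmu M (mmap M (fun u => match u with
                           | inl x => zmap i Y x
                           | inr y => meta M y
                           end) t)).

Definition is_additive : Prop :=
  exists i : unit -> T void,
    bijective i /\ forall X Y, bijective (@bc i X Y).

Record is_ACMnd : Prop := IsACMnd {
  acm_monad : is_monad;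
  acm_comm : is_commutative;
  acm_add : is_additive }.

End MonadNotions.

Record is_monad_map (T T' : Sets -> Sets) (M : monad_ops T) (M' : monad_ops T')
    (s : forall X : Sets, T X -> T' X) : Prop := IsMonadMap {
  mm_nat : forall (X Y : Sets) (f : X -> Y),
    s Y \o mmap M f =1 mmap M' f \o s X;
  mm_eta : forall X : Sets, s X \o meta M =1 meta M';
  mm_mu : forall X : Sets,
    s X \o mmu M =1 mmu M' \o mmap M' (s X) \o s (T X) }.

Record ACMnd_ob := ACMndOb {
  acm_set :> Sets -> Sets;
  acm_ops :> monad_ops acm_set;
  acmP : is_ACMnd acm_ops }.

Definition ACMnd_hom (T T' : ACMnd_ob) :=
  {s : forall X : Sets, T X -> T' X | is_monad_map T T' s}.

Lemma ACMnd_homP (T T' : ACMnd_ob) (s s' : ACMnd_hom T T') :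
  (forall X, sval s X =1 sval s' X) -> s = s'.
Proof.
move=> e; apply: sval_eq.
by apply: functional_extensionality_dep => X; apply: funext; apply: e.
Qed.

Lemma ACMnd_id_subproof (T : ACMnd_ob) :
  is_monad_map T T (fun X => @id (T X)).
Proof.
split=> // X t /=.
by rewrite (mmap_id (acm_monad (acmP T))).
Qed.

Lemma ACMnd_comp_subproof (T1 T2 T3 : ACMnd_ob)
    (s : ACMnd_hom T2 T3) (r : ACMnd_hom T1 T2) :
  is_monad_map T1 T3 (fun X => sval s X \o sval r X).
Proof.
case: s r => [s [sN sE sM]] [r [rN rE rM]]; split=> /=.
- by move=> X Y f t /=; have /= -> := rN _ _ f t; have /= -> := sN _ _ f (r X t).
- by move=> X x /=; have /= -> := rE _ x; have /= -> := sE _ x.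
- move=> X t /=; have /= -> := rM _ t.
  have /= -> := sM _ (mmap T2 (r X) (r _ t)).
  have /= -> := sN _ _ (r X) (r _ t).
  by rewrite (mmap_comp (acm_monad (acmP T3))).
Qed.

Definition ACMnd_id (T : ACMnd_ob) : ACMnd_hom T T :=
  exist _ _ (ACMnd_id_subproof T).

Definition ACMnd_comp (T1 T2 T3 : ACMnd_ob) (s : ACMnd_hom T2 T3)
    (r : ACMnd_hom T1 T2) : ACMnd_hom T1 T3 :=
  exist _ _ (ACMnd_comp_subproof s r).

Definition ACMnd : category.
Proof.
refine (@Category ACMnd_ob ACMnd_hom ACMnd_id ACMnd_comp _ _ _);
  by move=> *; apply: ACMnd_homP.
Defined.

Record is_involution (T : ACMnd_ob) (z : forall X : Sets, T X -> T X) : Prop :=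
  IsInvolution {
    inv_map : is_monad_map T T z;
    invK : forall X, involutive (z X) }.

Record IACMnd_ob := IACMndOb {
  iacm_acm :> ACMnd_ob;
  zeta : forall X : Sets, iacm_acm X -> iacm_acm X;
  zetaP : is_involution zeta }.

Definition IACMnd_hom (T T' : IACMnd_ob) :=
  {s : ACMnd_hom T T' |
    forall X, sval s X \o @zeta T X =1 @zeta T' X \o sval s X}.

Lemma IACMnd_id_subproof (T : IACMnd_ob) (X : Sets) :
  sval (ACMnd_id T) X \o @zeta T X =1 @zeta T X \o sval (ACMnd_id T) X.
Proof. by []. Qed.

Lemma IACMnd_comp_subproof (T1 T2 T3 : IACMnd_ob)
    (s : IACMnd_hom T2 T3) (r : IACMnd_hom T1 T2) (X : Sets) :
  sval (ACMnd_comp (sval s) (sval r)) X \o @zeta T1 X =1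
  @zeta T3 X \o sval (ACMnd_comp (sval s) (sval r)) X.
Proof.
case: s r => [s sZ] [r rZ] t /=.
by have /= -> := rZ X t; have /= -> := sZ X (sval r X t).
Qed.

Definition IACMnd_id (T : IACMnd_ob) : IACMnd_hom T T :=
  exist _ (ACMnd_id T) (@IACMnd_id_subproof T).

Definition IACMnd_comp (T1 T2 T3 : IACMnd_ob) (s : IACMnd_hom T2 T3)
    (r : IACMnd_hom T1 T2) : IACMnd_hom T1 T3 :=
  exist _ (ACMnd_comp (sval s) (sval r)) (IACMnd_comp_subproof s r).

Definition IACMnd : category.
Proof.
refine (@Category IACMnd_ob IACMnd_hom IACMnd_id IACMnd_comp _ _ _);
  by move=> *; do 2 apply: sval_eq.
Defined.

(* In the category aleph_0 the morphisms from n to m are all functions from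
   'I_n to 'I_m; the sum is given by [lshift] and [rshift].  Its tensor and coherence isomorphisms are
   transported from (Sets, *, 1) along [co]. *)

Lemma co_subproof1 n m (c : 'I_(n * m)) : c %/ m < n.
Proof.
case: m c => [|m] c; last by rewrite ltn_divLR ?ltn_ord.
by case: c => c; rewrite muln0.
Qed.

Lemma co_subproof2 n m (c : 'I_(n * m)) : c %% m < m.
Proof. by rewrite ltn_mod; case: m c => [|m] // [c]; rewrite muln0. Qed.

Lemma coV_subproof n m (p : 'I_n * 'I_m) : p.1 * m + p.2 < n * m.
Proof.
case: p => a b /=; apply: (@leq_trans (a.+1 * m)); last exact: leq_mul.
by rewrite mulSn addnC ltn_add2r.
Qed.

Definition co n m (c : 'I_(n * m)) : 'I_n * 'I_m :=
  (Ordinal (co_subproof1 c), Ordinal (co_subproof2 c)).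

Definition coV n m (p : 'I_n * 'I_m) : 'I_(n * m) := Ordinal (coV_subproof p).

Lemma coK n m : cancel (@co n m) (@coV n m).
Proof. by move=> c; apply: val_inj; rewrite /= -divn_eq. Qed.

Lemma coVK n m : cancel (@coV n m) (@co n m).
Proof.
case=> a b; have m_gt0 : 0 < m by apply: leq_ltn_trans (ltn_ord b).
congr pair; apply: val_inj => /=.
  by rewrite divnMDl // divn_small ?addn0.
by rewrite modnMDl modn_small.
Qed.

Definition otens n m n' m' (f : 'I_n -> 'I_m) (g : 'I_n' -> 'I_m') :
    'I_(n * n') -> 'I_(m * m') :=
  fun c => coV (f (co c).1, g (co c).2).

Definition oalpha n m k (c : 'I_(n * (m * k))) : 'I_(n * m * k) :=
  coV (coV ((co c).1, (co (co c).2).1), (co (co c).2).2).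

Definition olam n (c : 'I_(1 * n)) : 'I_n := (co c).2.

Definition orho n (c : 'I_(n * 1)) : 'I_n := (co c).1.

Definition ogam n m (c : 'I_(n * m)) : 'I_(m * n) := coV (swap (co c)).

Record law_data := LawData {
  Hom : nat -> nat -> Sets;
  lid : forall n, Hom n n;
  lcomp : forall n m k, Hom m k -> Hom n m -> Hom n k;
  emb : forall n m, ('I_n -> 'I_m) -> Hom n m;
  linit : forall n, Hom 0 n;
  copair : forall n m k, Hom n k -> Hom m k -> Hom (n + m) k }.

Arguments lid {_} _.
Arguments lcomp {_ _ _ _} _ _.
Arguments emb {_ _ _} _.
Arguments linit {_} _.
Arguments copair {_ _ _ _} _ _.

Declare Scope law_scope.
Infix "\oL" := lcomp (at level 50, left associativity) : law_scope.
Local Open Scope law_scope.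

Definition kap1 {L : law_data} n m : Hom L n (n + m) := emb (@lshift n m).
Definition kap2 {L : law_data} n m : Hom L m (n + m) := emb (@rshift n m).

(* The functor [emb] strictly preserves finite coproducts: 0 is initial, and
   n + m is a coproduct whose coprojections are the images of those of
   aleph_0. *)
Record is_Lawvere (L : law_data) : Prop := IsLawvere {
  lcomp1 : forall n m (f : Hom L n m), f \oL lid n = f;
  lcomp1l : forall n m (f : Hom L n m), lid m \oL f = f;
  lcompA : forall n m k l (h : Hom L k l) (g : Hom L m k) (f : Hom L n m),
    h \oL (g \oL f) = (h \oL g) \oL f;
  emb1 : forall n, emb id = lid n :> Hom L n n;
  embM : forall n m k (g : 'I_m -> 'I_k) (f : 'I_n -> 'I_m),
    emb (g \o f) = emb g \oL emb f :> Hom L n k;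
  linitP : forall n (f : Hom L 0 n), f = linit n;
  copair1 : forall n m k (f : Hom L n k) (g : Hom L m k),
    copair f g \oL kap1 n m = f;
  copair2 : forall n m k (f : Hom L n k) (g : Hom L m k),
    copair f g \oL kap2 n m = g;
  copairP : forall n m k (h : Hom L (n + m) k),
    h = copair (h \oL kap1 n m) (h \oL kap2 n m) }.

Record smb_data := SMBData {
  smb_law :> law_data;
  tens : forall n m n' m', Hom smb_law n m -> Hom smb_law n' m' ->
    Hom smb_law (n * n') (m * m');
  alpha : forall n m k, Hom smb_law (n * (m * k)) (n * m * k);
  lam : forall n, Hom smb_law (1 * n) n;
  rho : forall n, Hom smb_law (n * 1) n;
  gam : forall n m, Hom smb_law (n * m) (m * n);
  lterm : forall n, Hom smb_law n 0;
  pi1 : forall n m, Hom smb_law (n + m) n;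
  pi2 : forall n m, Hom smb_law (n + m) m;
  pair : forall n m k, Hom smb_law k n -> Hom smb_law k m ->
    Hom smb_law k (n + m) }.

Arguments tens {_ _ _ _ _} _ _.
Arguments alpha {_} _ _ _.
Arguments lam {_} _.
Arguments rho {_} _.
Arguments gam {_} _ _.
Arguments lterm {_} _.
Arguments pi1 {_} _ _.
Arguments pi2 {_} _ _.
Arguments pair {_ _ _ _} _ _.

Definition is_inverse (L : law_data) n m (f : Hom L n m) (f' : Hom L m n) :=
  f' \oL f = lid n /\ f \oL f' = lid m.

Record is_symmonoidal (L : smb_data) : Prop := IsSymMonoidal {
  tens1 : forall n m, tens (lid n) (lid m) = lid (n * m) :> Hom L _ _;
  tensM : forall n m k n' m' k'
      (g : Hom L m k) (f : Hom L n m) (g' : Hom L m' k') (f' : Hom L n' m'),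
    tens (g \oL f) (g' \oL f') = tens g g' \oL tens f f';
  alpha_nat : forall n m n' m' n'' m''
      (f : Hom L n m) (g : Hom L n' m') (h : Hom L n'' m''),
    alpha _ _ _ \oL tens f (tens g h) = tens (tens f g) h \oL alpha _ _ _;
  lam_nat : forall n m (f : Hom L n m),
    lam m \oL tens (lid 1) f = f \oL lam n;
  rho_nat : forall n m (f : Hom L n m),
    rho m \oL tens f (lid 1) = f \oL rho n;
  gam_nat : forall n m n' m' (f : Hom L n m) (g : Hom L n' m'),
    gam m m' \oL tens f g = tens g f \oL gam n n';
  alpha_iso : forall n m k, exists a, is_inverse (alpha n m k : Hom L _ _) a;
  lam_iso : forall n, exists a, is_inverse (lam n : Hom L _ _) a;
  rho_iso : forall n, exists a, is_inverse (rho n : Hom L _ _) a;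
  gamK : forall n m, gam m n \oL gam n m = lid (n * m) :> Hom L _ _;
  pentagon : forall a b c d,
    alpha (a * b) c d \oL alpha a b (c * d) =
    tens (alpha a b c) (lid d) \oL alpha a (b * c) d
      \oL tens (lid a) (alpha b c d) :> Hom L _ _;
  triangle : forall a b,
    tens (rho a) (lid b) \oL alpha a 1 b = tens (lid a) (lam b) :> Hom L _ _;
  hexagon : forall a b c,
    alpha c a b \oL gam (a * b) c \oL alpha a b c =
    tens (gam a c) (lid b) \oL alpha a c b
      \oL tens (lid a) (gam b c) :> Hom L _ _;
  lam_gam : forall n, lam n \oL gam n 1 = rho n :> Hom L _ _ }.

Record emb_strict (L : smb_data) : Prop := EmbStrict {
  emb_tens : forall n m n' m' (f : 'I_n -> 'I_m) (g : 'I_n' -> 'I_m'),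
    emb (otens f g) = tens (emb f) (emb g) :> Hom L _ _;
  emb_alpha : forall n m k, emb (@oalpha n m k) = alpha n m k :> Hom L _ _;
  emb_lam : forall n, emb (@olam n) = lam n :> Hom L _ _;
  emb_rho : forall n, emb (@orho n) = rho n :> Hom L _ _;
  emb_gam : forall n m, emb (@ogam n m) = gam n m :> Hom L _ _ }.

Definition lzero {L : smb_data} n m : Hom L n m := linit m \oL lterm n.

Record is_biproduct (L : smb_data) : Prop := IsBiproduct {
  ltermP : forall n (f : Hom L n 0), f = lterm n;
  pair1 : forall n m k (f : Hom L k n) (g : Hom L k m),
    pi1 n m \oL pair f g = f;
  pair2 : forall n m k (f : Hom L k n) (g : Hom L k m),
    pi2 n m \oL pair f g = g;
  pairP : forall n m k (h : Hom L k (n + m)),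
    h = pair (pi1 n m \oL h) (pi2 n m \oL h);
  pi1_kap1 : forall n m, pi1 n m \oL kap1 n m = lid n :> Hom L _ _;
  pi2_kap2 : forall n m, pi2 n m \oL kap2 n m = lid m :> Hom L _ _;
  pi1_kap2 : forall n m, pi1 n m \oL kap2 n m = lzero m n :> Hom L _ _;
  pi2_kap1 : forall n m, pi2 n m \oL kap1 n m = lzero n m :> Hom L _ _ }.

Record is_SMBLaw (L : smb_data) : Prop := IsSMBLaw {
  smb_lawvere : is_Lawvere L;
  smb_symmon : is_symmonoidal L;
  smb_strict : emb_strict L;
  smb_biprod : is_biproduct L }.

Record SMBLaw_ob := SMBLawOb {
  smb_obj :> smb_data;
  smbP : is_SMBLaw smb_obj }.

(* Compatibility with [emb] is implied by the preservation of the coproduct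
   structure, and is therefore not listed. *)
Record is_smb_map (L L' : smb_data) (F : forall n m, Hom L n m -> Hom L' n m) :
    Prop := IsSMBMap {
  sm_id : forall n, F _ _ (lid n) = lid n;
  sm_comp : forall n m k (g : Hom L m k) (f : Hom L n m),
    F _ _ (g \oL f) = F _ _ g \oL F _ _ f;
  sm_kap1 : forall n m, F _ _ (kap1 n m) = kap1 n m;
  sm_kap2 : forall n m, F _ _ (kap2 n m) = kap2 n m;
  sm_init : forall n, F _ _ (linit n) = linit n;
  sm_copair : forall n m k (f : Hom L n k) (g : Hom L m k),
    F _ _ (copair f g) = copair (F _ _ f) (F _ _ g);
  sm_tens : forall n m n' m' (f : Hom L n m) (g : Hom L n' m'),
    F _ _ (tens f g) = tens (F _ _ f) (F _ _ g);
  sm_alpha : forall n m k, F _ _ (alpha n m k) = alpha n m k;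
  sm_lam : forall n, F _ _ (lam n) = lam n;
  sm_rho : forall n, F _ _ (rho n) = rho n;
  sm_gam : forall n m, F _ _ (gam n m) = gam n m;
  sm_term : forall n, F _ _ (lterm n) = lterm n;
  sm_pi1 : forall n m, F _ _ (pi1 n m) = pi1 n m;
  sm_pi2 : forall n m, F _ _ (pi2 n m) = pi2 n m;
  sm_pair : forall n m k (f : Hom L k n) (g : Hom L k m),
    F _ _ (pair f g) = pair (F _ _ f) (F _ _ g) }.

Definition SMBLaw_hom (L L' : SMBLaw_ob) :=
  {F : forall n m, Hom L n m -> Hom L' n m | is_smb_map F}.

Definition SMBLaw_id (L : SMBLaw_ob) : SMBLaw_hom L L.
Proof. by exists (fun n m => @id (Hom L n m)); split. Defined.

Definition SMBLaw_comp (L1 L2 L3 : SMBLaw_ob) (G : SMBLaw_hom L2 L3)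
  (F : SMBLaw_hom L1 L2) : SMBLaw_hom L1 L3.
Proof.
exists (fun n m f => sval G n m (sval F n m f)).
case: G F => [G GP] [F FP]; abstract by split=> *;
  case: GP => *; case: FP => * /=;
  do ![match goal with H : _ |- _ => rewrite H end].
Defined.

Definition SMBLaw : category.
Proof.
refine (@Category SMBLaw_ob SMBLaw_hom SMBLaw_id SMBLaw_comp _ _ _);
  by move=> *; apply: sval_eq.
Defined.

Record is_dagger (L : smb_data) (d : forall n m, Hom L n m -> Hom L m n) :
    Prop := IsDagger {
  dag_id : forall n, d _ _ (lid n) = lid n;
  dag_comp : forall n m k (g : Hom L m k) (f : Hom L n m),
    d _ _ (g \oL f) = d _ _ f \oL d _ _ g;
  dagK : forall n m (f : Hom L n m), d _ _ (d _ _ f) = f;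
  dag_tens : forall n m n' m' (f : Hom L n m) (g : Hom L n' m'),
    d _ _ (tens f g) = tens (d _ _ f) (d _ _ g);
  dag_alpha : forall n m k, is_inverse (alpha n m k) (d _ _ (alpha n m k));
  dag_rho : forall n, is_inverse (rho n) (d _ _ (rho n));
  dag_gam : forall n m, is_inverse (gam n m) (d _ _ (gam n m));
  dag_pi1 : forall n m, kap1 n m = d _ _ (pi1 n m);
  dag_pi2 : forall n m, kap2 n m = d _ _ (pi2 n m) }.

Record DSMBLaw_ob := DSMBLawOb {
  dsmb_smb :> SMBLaw_ob;
  dag : forall n m, Hom dsmb_smb n m -> Hom dsmb_smb m n;
  dagP : is_dagger dag }.

Arguments dag {_ _ _} _.

Definition DSMBLaw_hom (L L' : DSMBLaw_ob) :=
  {F : SMBLaw_hom L L' |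
    forall n m (f : Hom L n m), sval F m n (dag f) = dag (sval F n m f)}.

Definition DSMBLaw_id (L : DSMBLaw_ob) : DSMBLaw_hom L L.
Proof. by exists (SMBLaw_id L). Defined.

Definition DSMBLaw_comp (L1 L2 L3 : DSMBLaw_ob) (G : DSMBLaw_hom L2 L3)
  (F : DSMBLaw_hom L1 L2) : DSMBLaw_hom L1 L3.
Proof.
exists (SMBLaw_comp (sval G) (sval F)).
abstract (by case: G F => [G Gd] [F Fd] n m f /=; rewrite Fd Gd).
Defined.

Definition DSMBLaw : category.
Proof.
refine (@Category DSMBLaw_ob DSMBLaw_hom DSMBLaw_id DSMBLaw_comp _ _ _);
  by move=> *; do 2 apply: sval_eq.
Defined.

Definition from0 (A : Type) (c : 'I_0) : A := False_rect A (notF (ltn_ord c)).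

Lemma bij_ex (A B : Type) (f : A -> B) :
  bijective f -> exists g, cancel f g /\ cancel g f.
Proof. by case=> g fK gK; exists g. Qed.

Definition bij_inv (A B : Type) (f : A -> B) (h : bijective f) : B -> A :=
  sval (cid (bij_ex h)).

Section Kleisli.
Variable T : ACMnd_ob.

Definition iso0 : unit -> T void := sval (cid (acm_add (acmP T))).

Definition bcV (X Y : Sets) : T X * T Y -> T (X + Y)%type :=
  bij_inv ((svalP (cid (acm_add (acmP T)))).2 X Y).

Definition Kl_hom (n m : nat) : Sets := 'I_n -> T 'I_m.

Definition Kl_zero n m : Kl_hom n m := zmap T iso0 'I_m.
Arguments Kl_zero : clear implicits.

Definition Kl_comp n m k (g : Kl_hom m k) (f : Kl_hom n m) : Kl_hom n k :=
  mmu T \o mmap T g \o f.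

Definition Kl_law : law_data :=
  @LawData Kl_hom (fun n => meta T) Kl_comp
    (fun n m f => meta T \o f)
    (fun n => @from0 (T 'I_n))
    (fun n m k f g c => match fintype.split c with
                        | inl a => f a
                        | inr b => g b
                        end).

Definition Kl_tens n m n' m' (f : Kl_hom n m) (g : Kl_hom n' m') :
    Kl_hom (n * n') (m * m') :=
  fun c => mmap T (@coV m m') (dst T (f (co c).1, g (co c).2)).

Definition Kl_smb : smb_data :=
  @SMBData Kl_law Kl_tens
    (fun n m k => meta T \o @oalpha n m k)
    (fun n => meta T \o @olam n)
    (fun n => meta T \o @orho n)
    (fun n m => meta T \o @ogam n m)
    (fun n => Kl_zero n 0)
    (fun n m c => match fintype.split c with
                  | inl a => meta T a
                  | inr b => Kl_zero m n b
                  end)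
    (fun n m c => match fintype.split c with
                  | inl a => Kl_zero n m a
                  | inr b => meta T b
                  end)
    (fun n m k f g c => mmap T (@unsplit n m) (bcV (f c, g c))).

(* The j-th component of the m-fold version of [bc] is induced by the map
   sending j to the unit and every other index to 0. *)
Definition bcm m (t : T 'I_m) (j : 'I_m) : T unit :=
  mmu T (mmap T (fun k => if k == j then meta T tt
                          else zmap T iso0 unit k) t).

Definition theta n m (g : Kl_hom n m) (i : 'I_n) (j : 'I_m) : T unit :=
  bcm (g i) j.

End Kleisli.

(* As [theta] is a bijection, there is exactly one h as below; the default
   value of [xget] is never used. *)
Definition Kl_dag (T : IACMnd_ob) n m (g : Kl_hom T n m) : Kl_hom T m n :=
  @xget {classic (Kl_hom T m n)} (@Kl_zero T m n)
    (fun h : Kl_hom T m n =>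
       forall i j, theta h j i = zeta (theta g i j)).

Section TL.
Variable L : smb_data.

Definition TLpre (X : Sets) : Sets := {i : nat & Hom L 1 i * ('I_i -> X)}%type.

Definition TLin (X : Sets) i (g : Hom L 1 i) (v : 'I_i -> X) : TLpre X :=
  existT _ i (g, v).

Inductive TLstep (X : Sets) : TLpre X -> TLpre X -> Prop :=
  TLStep i m (f : 'I_i -> 'I_m) (g : Hom L 1 i) (v : 'I_m -> X) :
    TLstep (TLin (emb f \oL g) v) (TLin g (v \o f)).

Definition TLsim (X : Sets) (x y : {classic (TLpre X)}) : bool :=
  `[< clos_refl_sym_trans _ (@TLstep X) x y >].

Lemma TLsim_refl X : reflexive (@TLsim X).
Proof. by move=> x; apply/asboolP; apply: rst_refl. Qed.

Lemma TLsim_sym X : symmetric (@TLsim X).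
Proof. by move=> x y; apply/asboolP/asboolP; apply: rst_sym. Qed.

Lemma TLsim_trans X : transitive (@TLsim X).
Proof.
by move=> y x z /asboolP xy /asboolP yz; apply/asboolP; apply: rst_trans yz.
Qed.

Definition TLequiv (X : Sets) : equiv_rel {classic (TLpre X)} :=
  EquivRel (@TLsim X) (@TLsim_refl X) (@TLsim_sym X) (@TLsim_trans X).

Definition TL (X : Sets) : Sets := {eq_quot TLequiv X}.

Definition cls (X : Sets) i (g : Hom L 1 i) (v : 'I_i -> X) : TL X :=
  \pi_({eq_quot TLequiv X}) (TLin g v : {classic (TLpre X)}).

(* [cotuple] is the cotuple out of the i-fold sum 1 + ... + 1 = i, and [tuple]
   the tuple into the same object seen as an i-fold product; note that
   1 + i is convertible to i.+1. *)
Fixpoint cotuple k i : ('I_i -> Hom L 1 k) -> Hom L i k :=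
  match i with
  | 0 => fun _ => linit k
  | i'.+1 => fun g =>
      @copair L 1 i' k (g ord0) (cotuple (fun a => g (lift ord0 a)))
  end.

Fixpoint tuple k i : ('I_i -> Hom L k 1) -> Hom L k i :=
  match i with
  | 0 => fun _ => lterm k
  | i'.+1 => fun g =>
      @pair L 1 i' k (g ord0) (tuple (fun a => g (lift ord0 a)))
  end.

(* The map g_0 + ... + g_{i-1}; [tagnat.Rank a] is the a-th coprojection
   b |-> j_0 + ... + j_{a-1} + b. *)
Definition summap i (j : 'I_i -> nat) (g : forall a, Hom L 1 (j a)) :
    Hom L i (\sum_(a < i) j a) :=
  cotuple (fun a => emb (@tagnat.Rank i j a) \oL g a).

Record is_TL_ops (M : monad_ops TL) : Prop := IsTLOps {
  TL_map : forall (X Y : Sets) (h : X -> Y) i (g : Hom L 1 i) (v : 'I_i -> X),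
    mmap M h (cls g v) = cls g (h \o v);
  TL_eta : forall (X : Sets) (x : X), meta M x = cls (lid 1) (fun _ => x);
  TL_mu : forall (X : Sets) i (g : Hom L 1 i) (j : 'I_i -> nat)
      (g_ : forall a, Hom L 1 (j a)) (v_ : forall a, 'I_(j a) -> X),
    mmu M (cls g (fun a => cls (g_ a) (v_ a))) =
    cls (summap g_ \oL g)
        (fun c => v_ (tagnat.sig1 c) (tagnat.sig2 c)) }.

End TL.

Definition is_TL_zeta (L : DSMBLaw_ob) (z : forall X : Sets, TL L X -> TL L X) :
    Prop :=
  forall (X : Sets) i (g : 'I_i -> Hom L 1 1) (v : 'I_i -> X),
    z X (cls (tuple g) v) = cls (tuple (fun a => dag (g a))) v.

(* Main.v *)
From Stdlib Require Import Relations.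
From mathcomp Require Import all_boot all_order generic_quotient.
From mathcomp Require Import boolp classical_sets.
Require Import Defs.

Set Implicit Arguments.
Unset Strict Implicit.
Unset Printing Implicit Defensive.

Local Open Scope quotient_scope.
Local Open Scope law_scope.

(* In a theory with biproducts a morphism is a matrix of scalars, i.e. of
   endomorphisms of 1, and the tensor is determined by composition and the
   image of aleph_0; hence an identity-on-objects map preserving composition
   and that image preserves all the structure.  Scalars commute, so the dagger
   restricts to a semiring involution of the scalars, and a dagger is the same
   thing as such an involution: it is the transpose followed by the entrywise
   involution.  The entrywise involution without the transpose is an
   endomorphism of the theory, and zeta is its image under the functor T.

   A function q : X -> L(1, n) extends to T_L(X) -> L(1, n), and these
   extensions are jointly injective because finitely many elements of X can be
   separated by a function to some 'I_n.  All equations in T_L(X), including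
   the well-definedness of the multiplication, are checked through them; there
   commutativity is the interchange law of the tensor, and additivity is the
   biproduct structure.

   The unit of the adjunction sends g : n -> m to the family of classes
   [g o kappa_c, id], and the transpose of F : L -> Kl(S) sends [g, v] to
   S(v)(F(g)). *)

(** * Lawvere theories with biproducts *)

Section LawvereTheory.
Variables (L : smb_data) (LP : is_Lawvere L).
Implicit Types n m k l : nat.

(** The i-th coprojection of n as an n-fold copower of 1. *)
Definition pt n (i : 'I_n) : Hom L 1 n := emb (fun=> i).

Lemma pt_ord0 n : pt ord0 = kap1 1 n :> Hom L 1 n.+1.
Proof. by congr emb; apply: funext => a; apply: val_inj; rewrite ord1. Qed.

Lemma pt_lift n (i : 'I_n) : pt (lift ord0 i) = kap2 1 n \oL pt i.
Proof.
rewrite /kap2 -(embM LP); congr emb.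
by apply: funext => a; apply: val_inj.
Qed.

Lemma pt1 : pt ord0 = lid 1 :> Hom L 1 1.
Proof. by rewrite -(emb1 LP); congr emb; apply: funext => a; rewrite ord1. Qed.

Lemma emb_pt n m (f : 'I_n -> 'I_m) i : emb f \oL pt i = pt (f i).
Proof. by rewrite -(embM LP). Qed.

Lemma lcomp_init n m (f : Hom L n m) : f \oL linit n = linit m.
Proof. exact: linitP. Qed.

Lemma copair_eq n m k (f g : Hom L (n + m) k) :
  f \oL kap1 n m = g \oL kap1 n m -> f \oL kap2 n m = g \oL kap2 n m -> f = g.
Proof. by move=> e1 e2; rewrite (copairP LP f) e1 e2 -copairP. Qed.

(** Peel off one summand 1 at a time: [kap1 1 n] is the first point, and [kap2 1 n] shifts the
    remaining ones. Most equations between morphisms below are checked on points. *)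
Lemma pt_inj n m (f g : Hom L n m) :
  (forall i, f \oL pt i = g \oL pt i) -> f = g.
Proof.
elim: n f g => [|n IHn] f g e; first by rewrite (linitP LP f) (linitP LP g).
apply: (@copair_eq 1 n); first by rewrite -pt_ord0.
by apply: IHn => i; rewrite -!(lcompA LP) -pt_lift.
Qed.

(* The rewriting lemmas for sums do not match at 1 + n, whose
   instances have type n.+1, only convertible to it. *)
Lemma copair_pt0 n m (f : Hom L 1 m) (g : Hom L n m) :
  (@copair L 1 n m f g : Hom L n.+1 m) \oL pt ord0 = f.
Proof. by rewrite pt_ord0; apply: copair1. Qed.

Lemma copair_ptS n m (f : Hom L 1 m) (g : Hom L n m) i :
  (@copair L 1 n m f g : Hom L n.+1 m) \oL pt (lift ord0 i) = g \oL pt i.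
Proof. by rewrite pt_lift (lcompA LP); congr lcomp; exact: (copair2 LP f g). Qed.

Lemma cotuple_pt n m (f : 'I_n -> Hom L 1 m) i : cotuple f \oL pt i = f i.
Proof.
elim: n f i => [|n IHn] f i; first by case: i.
case: (unliftP ord0 i) => [a ->|->] /=.
  by rewrite copair_ptS IHn.
by rewrite copair_pt0.
Qed.

Lemma cotupleE n m (f : Hom L n m) : cotuple (fun i => f \oL pt i) = f.
Proof. by apply: pt_inj => i; rewrite cotuple_pt. Qed.

Lemma comp_cotuple n m k (h : Hom L m k) (f : 'I_n -> Hom L 1 m) :
  h \oL cotuple f = cotuple (fun i => h \oL f i).
Proof. by apply: pt_inj => i; rewrite -(lcompA LP) !cotuple_pt. Qed.

Lemma cotuple_emb n m k (f : 'I_n -> 'I_m) (q : 'I_m -> Hom L 1 k) :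
  cotuple q \oL emb f = cotuple (q \o f).
Proof. by apply: pt_inj => i; rewrite -(lcompA LP) emb_pt !cotuple_pt. Qed.

Lemma embE n m (f : 'I_n -> 'I_m) : cotuple (fun i => pt (f i)) = emb f.
Proof. by apply: pt_inj => i; rewrite cotuple_pt emb_pt. Qed.

Lemma cotuple_copair n m k (q : 'I_(n + m) -> Hom L 1 k) :
  cotuple q = copair (cotuple (q \o @lshift n m)) (cotuple (q \o @rshift n m)).
Proof.
by apply: copair_eq; rewrite ?copair1 ?copair2 // cotuple_emb.
Qed.

End LawvereTheory.

(** * Addition of morphisms and projections onto 1, from the biproducts *)

Section SMBLawTheory.
Variable L : SMBLaw_ob.
Let BP := smb_biprod (smbP L).
Let LP := smb_lawvere (smbP L).
Let SP := smb_symmon (smbP L).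
Let EP := smb_strict (smbP L).
Implicit Types n m k l : nat.
Local Notation pt := (@pt L _).

Lemma lzerol n m k (f : Hom L m k) : f \oL lzero n m = lzero n k.
Proof. by rewrite /lzero (lcompA LP) lcomp_init. Qed.

Lemma lzeror n m k (f : Hom L n m) : lzero m k \oL f = lzero n k.
Proof. by rewrite /lzero -(lcompA LP); congr lcomp; apply: ltermP. Qed.

Lemma pair_eq n m k (f g : Hom L k (n + m)) :
  pi1 n m \oL f = pi1 n m \oL g -> pi2 n m \oL f = pi2 n m \oL g -> f = g.
Proof. by move=> e1 e2; rewrite (pairP BP f) e1 e2 -pairP. Qed.

Lemma pair_comp n m k l (f : Hom L k n) (g : Hom L k m) (h : Hom L l k) :
  pair f g \oL h = pair (f \oL h) (g \oL h).
Proof. by apply: pair_eq; rewrite (lcompA LP) ?pair1 ?pair2. Qed.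

(** The addition that biproducts induce on hom-sets: the codiagonal after a pairing. *)
Definition ladd n m (f g : Hom L n m) : Hom L n m :=
  copair (lid m) (lid m) \oL pair f g.

Lemma ladd_comp n m k (f g : Hom L m k) (h : Hom L n m) :
  ladd f g \oL h = ladd (f \oL h) (g \oL h).
Proof. by rewrite /ladd -(lcompA LP) pair_comp. Qed.

(** The cotuple factors as the codiagonal after the biproduct map of [f] and [g], called [h]. As [h]
    is written as a pairing, its composites with the coprojections are computed through the
    projections. *)
Lemma copair_pair n m k l (f : Hom L n k) (g : Hom L m k) (f' : Hom L l n)
    (g' : Hom L l m) :
  copair f g \oL pair f' g' = ladd (f \oL f') (g \oL g').
Proof.
pose h : Hom L (n + m) (k + k) := pair (f \oL pi1 n m) (g \oL pi2 n m).
have -> : copair f g = copair (lid k) (lid k) \oL h.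
  have h1 : h \oL kap1 n m = kap1 k k \oL f.
    rewrite pair_comp -!(lcompA LP) (pi1_kap1 BP) (pi2_kap1 BP) lzerol.
    apply: pair_eq; rewrite ?pair1 ?pair2 // (lcompA LP) ?pi1_kap1 ?pi2_kap1 //.
      by rewrite (lcomp1 LP) (lcomp1l LP).
    by rewrite lzeror.
  have h2 : h \oL kap2 n m = kap2 k k \oL g.
    rewrite pair_comp -!(lcompA LP) (pi1_kap2 BP) (pi2_kap2 BP) lzerol.
    apply: pair_eq; rewrite ?pair1 ?pair2 // (lcompA LP) ?pi1_kap2 ?pi2_kap2 //.
      by rewrite lzeror.
    by rewrite (lcomp1 LP) (lcomp1l LP).
  apply: (copair_eq LP); rewrite -(lcompA LP) ?h1 ?h2 (lcompA LP).
    by rewrite !copair1 // (lcomp1l LP).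
  by rewrite !copair2 // (lcomp1l LP).
by rewrite -(lcompA LP) pair_comp -!(lcompA LP) pair1 ?pair2.
Qed.

Lemma ladd0r n m (f : Hom L n m) : ladd f (lzero n m) = f.
Proof.
rewrite /ladd; have -> : pair f (lzero n m) = kap1 m m \oL f.
  apply: pair_eq; rewrite ?pair1 ?pair2 // (lcompA LP) ?pi1_kap1 ?pi2_kap1 //.
    by rewrite (lcomp1l LP).
  by rewrite lzeror.
by rewrite (lcompA LP) copair1 // (lcomp1l LP).
Qed.

Lemma ladd0l n m (f : Hom L n m) : ladd (lzero n m) f = f.
Proof.
rewrite /ladd; have -> : pair (lzero n m) f = kap2 m m \oL f.
  apply: pair_eq; rewrite ?pair1 ?pair2 // (lcompA LP) ?pi1_kap2 ?pi2_kap2 //.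
    by rewrite lzeror.
  by rewrite (lcomp1l LP).
by rewrite (lcompA LP) copair2 // (lcomp1l LP).
Qed.

Definition ldelta n (i j : 'I_n) : Hom L 1 1 :=
  if i == j then lid 1 else lzero 1 1.

(** The j-th projection of n as a power of 1, given by its Kronecker deltas on points; [pr_ord0] and
    [pr_lift] relate it to the binary projections. *)
Definition pr n (j : 'I_n) : Hom L n 1 := cotuple (fun i => ldelta i j).

Lemma pr_pt n (i j : 'I_n) : pr j \oL pt i = ldelta i j.
Proof. exact: cotuple_pt. Qed.

Lemma pi1_pt0 n : (pi1 1 n : Hom L n.+1 1) \oL pt ord0 = lid 1.
Proof. by rewrite pt_ord0; apply: pi1_kap1. Qed.

Lemma pi1_ptS n (i : 'I_n) :
  (pi1 1 n : Hom L n.+1 1) \oL pt (lift ord0 i) = lzero 1 1.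
Proof.
rewrite pt_lift // (lcompA LP) -[RHS](lzeror 1 (pt i)).
by congr lcomp; apply: pi1_kap2.
Qed.

Lemma pi2_pt0 n : (pi2 1 n : Hom L n.+1 n) \oL pt ord0 = lzero 1 n.
Proof. by rewrite pt_ord0; apply: pi2_kap1. Qed.

Lemma pi2_ptS n (i : 'I_n) :
  (pi2 1 n : Hom L n.+1 n) \oL pt (lift ord0 i) = pt i.
Proof.
rewrite pt_lift // (lcompA LP) -[RHS](lcomp1l LP).
by congr lcomp; exact: (pi2_kap2 BP 1 n).
Qed.

Lemma pr_ord0 n : pr ord0 = pi1 1 n :> Hom L n.+1 1.
Proof.
apply: pt_inj => // i; rewrite pr_pt; case: (unliftP ord0 i) => [a ->|->].
  by rewrite pi1_ptS.
by rewrite pi1_pt0.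
Qed.

Lemma pr_lift n (j : 'I_n) :
  pr (lift ord0 j) = pr j \oL (pi2 1 n : Hom L n.+1 n).
Proof.
apply: pt_inj => // i; rewrite pr_pt -(lcompA LP).
case: (unliftP ord0 i) => [a ->|->].
  by rewrite pi2_ptS pr_pt /ldelta (inj_eq lift_inj).
by rewrite pi2_pt0 lzerol.
Qed.

Lemma pr_inj n k (f g : Hom L k n) :
  (forall j, pr j \oL f = pr j \oL g) -> f = g.
Proof.
elim: n f g => [|n IHn] f g e; first by rewrite (ltermP BP f) (ltermP BP g).
apply: (@pair_eq 1 n); first by rewrite -pr_ord0.
by apply: IHn => j; rewrite !(lcompA LP) -pr_lift.
Qed.

Lemma pr_pair0 n k (f : Hom L k 1) (g : Hom L k n) :
  pr ord0 \oL (@pair L 1 n k f g : Hom L k n.+1) = f.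
Proof. by rewrite pr_ord0; apply: pair1. Qed.

Lemma pr_pairS n k (f : Hom L k 1) (g : Hom L k n) j :
  pr (lift ord0 j) \oL (@pair L 1 n k f g : Hom L k n.+1) = pr j \oL g.
Proof. by rewrite pr_lift -(lcompA LP); congr lcomp; exact: (pair2 BP f g). Qed.

Lemma pr_tuple n k (f : 'I_n -> Hom L k 1) j : pr j \oL tuple f = f j.
Proof.
elim: n f j => [|n IHn] f j; first by case: j.
case: (unliftP ord0 j) => [a ->|->] /=.
  by rewrite pr_pairS IHn.
by rewrite pr_pair0.
Qed.

Lemma scalar_embE (f : 'I_1 -> 'I_1) : emb f = lid 1 :> Hom L 1 1.
Proof. by rewrite -(emb1 LP); congr emb; apply: funext => a; rewrite !ord1. Qed.

(** By functoriality the tensor is [tens (lid m) (pt b)], which comes from [aleph_0], after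
    [tens f (lid 1)], which naturality of [rho] identifies with [f]. The types fit because [1 * 1]
    reduces to [1], and [rho 1] is the identity. *)
Lemma tens_pt m m' (f : Hom L 1 m) (b : 'I_m') :
  tens f (pt b) = emb (fun a => coV (a, b)) \oL f :> Hom L (1 * 1) (m * m').
Proof.
have rho1 : rho 1 = lid 1 :> Hom L (1 * 1) 1 by rewrite -(emb_rho EP) scalar_embE.
rewrite -{1}(lcomp1l LP f) -(lcomp1 LP (pt b)) (tensM SP) -(emb1 LP).
rewrite -(emb_tens EP).
have := rho_nat SP f; rewrite rho1 (lcomp1 LP) => {2}<-.
by rewrite (lcompA LP) -(emb_rho EP) -(embM LP).
Qed.

End SMBLawTheory.

(** * The tensor in terms of composition, and commutativity of scalars *)

Section SMBLawTensor.
Variable L : SMBLaw_ob.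
Let LP := smb_lawvere (smbP L).
Let SP := smb_symmon (smbP L).
Let EP := smb_strict (smbP L).
Implicit Types n m k l : nat.
Local Notation pt := (@pt L _).

Lemma pt_coV n m (a : 'I_n) (b : 'I_m) :
  pt (coV (a, b)) = tens (pt a) (pt b) :> Hom L (1 * 1) (n * m).
Proof. exact: (emb_tens EP (fun=> a) (fun=> b)). Qed.

Lemma tens_coV n m n' m' (f : Hom L n m) (g : Hom L n' m') a b :
  tens f g \oL pt (coV (a, b)) =
  tens (f \oL pt a) (g \oL pt b) :> Hom L (1 * 1) (m * m').
Proof. by rewrite (tensM SP) -pt_coV. Qed.

(** Split the tensor as [tens f (lid m')] after [tens (lid 1) g]. The first factor is found point by
    point with [tens_pt], and naturality of [lam] turns the second into [g]. *)
Lemma tens_scalarl m m' (f : Hom L 1 m) (g : Hom L 1 m') :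
  tens f g = cotuple (fun b => emb (fun a => coV (a, b)) \oL f) \oL g
    :> Hom L (1 * 1) (m * m').
Proof.
set Q := cotuple _.
have tQ : tens f (lid m') = Q \oL lam m'.
  apply: (pt_inj LP) => c; rewrite -[c]coK; case: (co c) => a b.
  rewrite tens_coV (lcomp1l LP) [a]ord1 pt1 // (lcomp1 LP) tens_pt.
  rewrite -(lcompA LP) -(emb_lam EP) emb_pt // /olam coVK /=.
  by rewrite cotuple_pt.
have lam1 : lam 1 = lid 1 :> Hom L (1 * 1) 1.
  by rewrite -(emb_lam EP) scalar_embE.
rewrite -{1}(lcomp1 LP f) -(lcomp1l LP g) (tensM SP) tQ -(lcompA LP).
by rewrite (lam_nat SP) lam1 (lcomp1 LP) (lcomp1l LP).
Qed.

(** Mirror image of [tens_scalarl], obtained from the symmetry: [gam 1 1] is the identity, and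
    [gam m' m] swaps the encoded pairs. *)
Lemma tens_scalarr m m' (f : Hom L 1 m) (g : Hom L 1 m') :
  tens f g = cotuple (fun a => emb (fun b => coV (a, b)) \oL g) \oL f
    :> Hom L (1 * 1) (m * m').
Proof.
have gam1 : gam 1 1 = lid 1 :> Hom L (1 * 1) (1 * 1).
  by rewrite -(emb_gam EP) scalar_embE.
have := gam_nat SP f g; rewrite gam1 (lcomp1 LP) (tens_scalarl g f).
move=> /(congr1 (lcomp (gam m' m))); rewrite !(lcompA LP) (gamK SP).
rewrite (lcomp1l LP) => ->; congr lcomp.
rewrite comp_cotuple //; congr cotuple; apply: funext => a.
rewrite (lcompA LP) -(emb_gam EP) -(embM LP); congr (emb _ \oL _).
by apply: funext => b; rewrite /ogam /= coVK.
Qed.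

Lemma tens_scalar (f g : Hom L 1 1) :
  tens f g = f \oL g :> Hom L (1 * 1) (1 * 1).
Proof.
rewrite tens_scalarl -[in LHS](lcomp1 LP (cotuple _)) -(pt1 LP).
by rewrite cotuple_pt // scalar_embE (lcomp1l LP).
Qed.

(** An Eckmann-Hilton argument: the two evaluations of [tens f g] give the two orders of
    composition. *)
Lemma scalarC (f g : Hom L 1 1) : f \oL g = g \oL f.
Proof.
rewrite -tens_scalar tens_scalarr -[in LHS](lcomp1 LP (cotuple _)) -(pt1 LP).
by rewrite cotuple_pt // scalar_embE (lcomp1l LP).
Qed.

End SMBLawTensor.

(** * Maps that preserve composition and the image of [aleph_0] *)

Section SMBMap.
Variables (L L' : SMBLaw_ob) (F : forall n m, Hom L n m -> Hom L' n m).
Arguments F {n m} _.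
Hypothesis F_comp : forall n m k (g : Hom L m k) (f : Hom L n m),
  F (g \oL f) = F g \oL F f.
Hypothesis F_emb : forall n m (f : 'I_n -> 'I_m), F (emb f) = emb f.
Let LP := smb_lawvere (smbP L).
Let LP' := smb_lawvere (smbP L').
Let BP := smb_biprod (smbP L).
Let BP' := smb_biprod (smbP L').
Let EP := smb_strict (smbP L).
Let EP' := smb_strict (smbP L').

Let F_pt n (i : 'I_n) : F (pt L i) = pt L' i.
Proof. exact: F_emb. Qed.

Lemma smb_map_cotuple n m (f : 'I_n -> Hom L 1 m) :
  F (cotuple f) = cotuple (fun i => F (f i)).
Proof.
by apply: (pt_inj LP') => i; rewrite -F_pt -F_comp F_pt !cotuple_pt.
Qed.

(** Zero maps are preserved because 0 is initial and terminal, so the projections are preserved,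
    being determined by their composites with the coprojections; universal properties give copairing
    and pairing. Coherence isomorphisms lie in the image of [aleph_0]. *)
Lemma is_smb_map_emb : is_smb_map (@F).
Proof.
have F_id n : F (lid n) = lid n by rewrite -!emb1 // F_emb.
have F_init n : F (linit n) = linit n by apply: linitP.
have F_term n : F (lterm n) = lterm n by apply: ltermP.
have F_0 n m : F (lzero n m) = lzero n m by rewrite /lzero F_comp F_init F_term.
have F_kap1 n m : F (kap1 n m) = kap1 n m by apply: F_emb.
have F_kap2 n m : F (kap2 n m) = kap2 n m by apply: F_emb.
have F_pi1 n m : F (pi1 n m) = pi1 n m.
  apply: (copair_eq LP'); rewrite -?F_kap1 -?F_kap2 -F_comp.
    by rewrite (pi1_kap1 BP) F_kap1 (pi1_kap1 BP') F_id.
  by rewrite (pi1_kap2 BP) F_kap2 (pi1_kap2 BP') F_0.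
have F_pi2 n m : F (pi2 n m) = pi2 n m.
  apply: (copair_eq LP'); rewrite -?F_kap1 -?F_kap2 -F_comp.
    by rewrite (pi2_kap1 BP) F_kap1 (pi2_kap1 BP') F_0.
  by rewrite (pi2_kap2 BP) F_kap2 (pi2_kap2 BP') F_id.
split=> //.
- move=> n m k f g; apply: (copair_eq LP').
    by rewrite -F_kap1 -F_comp F_kap1 !copair1.
  by rewrite -F_kap2 -F_comp F_kap2 !copair2.
(* On the point [coV (a, b)] the tensor is one of maps out of 1, which [tens_scalarl] expresses by
   cotuples, composition and [emb]. *)
- move=> n m n' m' f g; apply: (pt_inj LP') => c.
  rewrite -[c]coK; case: (co c) => a b.
  rewrite -F_pt -F_comp F_pt !tens_coV -!F_pt -!F_comp.
  rewrite !tens_scalarl F_comp smb_map_cotuple; congr (cotuple _ \oL _).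
  by apply: funext => i; rewrite F_comp F_emb.
- by move=> n m k; rewrite -emb_alpha // F_emb emb_alpha.
- by move=> n; rewrite -emb_lam // F_emb emb_lam.
- by move=> n; rewrite -emb_rho // F_emb emb_rho.
- by move=> n m; rewrite -emb_gam // F_emb emb_gam.
- move=> n m k f g; apply: pair_eq.
    by rewrite -F_pi1 -F_comp F_pi1 !pair1.
  by rewrite -F_pi2 -F_comp F_pi2 !pair2.
Qed.

End SMBMap.

Section SMBMapTheory.
Variables (L L' : SMBLaw_ob) (F : forall n m, Hom L n m -> Hom L' n m).
Arguments F {n m} _.
Hypothesis FP : is_smb_map (@F).
Let LP := smb_lawvere (smbP L).
Let LP' := smb_lawvere (smbP L').

Lemma smb_map_pt n (i : 'I_n) : F (pt L i) = pt L' i.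
Proof.
elim: n i => [|n IHn] i; first by case: i.
case: (unliftP ord0 i) => [a ->|->].
  rewrite !pt_lift // (sm_comp FP) IHn; congr lcomp; exact: (sm_kap2 FP 1 n).
by rewrite !pt_ord0; apply: (sm_kap1 FP 1 n).
Qed.

Lemma smb_map_emb n m (f : 'I_n -> 'I_m) : F (emb f) = emb f.
Proof.
apply: (pt_inj LP') => i.
by rewrite -{1}smb_map_pt -(sm_comp FP) !emb_pt // smb_map_pt.
Qed.

Lemma smb_map_zero n m : F (lzero n m) = lzero n m.
Proof. by rewrite /lzero (sm_comp FP) (sm_init FP) (sm_term FP). Qed.

Lemma smb_map_add n m (f g : Hom L n m) : F (ladd f g) = ladd (F f) (F g).
Proof.
by rewrite /ladd (sm_comp FP) (sm_copair FP) (sm_pair FP) (sm_id FP).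
Qed.

Lemma smb_map_pr n (j : 'I_n) : F (pr L j) = pr L' j.
Proof.
rewrite /pr smb_map_cotuple ?smb_map_emb //; first last.
- by move=> *; apply: smb_map_emb.
- exact: sm_comp FP.
congr cotuple; apply: funext => i; rewrite /ldelta.
by case: eqP; rewrite ?(sm_id FP) ?smb_map_zero.
Qed.

Lemma smb_map_summap i (j : 'I_i -> nat) (g : forall a, Hom L 1 (j a)) :
  F (summap g) = summap (fun a => F (g a)).
Proof.
rewrite /summap smb_map_cotuple; first last.
- by move=> *; apply: smb_map_emb.
- exact: sm_comp FP.
congr cotuple; apply: funext => a.
by rewrite (sm_comp FP) smb_map_emb.
Qed.

End SMBMapTheory.

(** * Matrices of scalars *)

Section Matrix.
Variable L : SMBLaw_ob.
Let BP := smb_biprod (smbP L).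
Let LP := smb_lawvere (smbP L).
Let SP := smb_symmon (smbP L).
Let EP := smb_strict (smbP L).
Implicit Types n m k l : nat.
Local Notation pt := (@pt L _).
Local Notation pr := (@pr L _).

Definition ent n m (f : Hom L n m) (i : 'I_n) (j : 'I_m) : Hom L 1 1 :=
  pr j \oL f \oL pt i.

Definition ofmx n m (M : 'I_n -> 'I_m -> Hom L 1 1) : Hom L n m :=
  cotuple (fun i => tuple (M i)).

Lemma ent_ofmx n m (M : 'I_n -> 'I_m -> Hom L 1 1) i j : ent (ofmx M) i j = M i j.
Proof. by rewrite /ent -(lcompA LP) cotuple_pt // pr_tuple. Qed.

Lemma ent_inj n m (f g : Hom L n m) : (forall i j, ent f i j = ent g i j) -> f = g.
Proof.
move=> e; apply: (pt_inj LP) => i; apply: pr_inj => j.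
by rewrite !(lcompA LP); apply: e.
Qed.

Lemma ent_scalarr m (f : Hom L 1 m) j : ent f ord0 j = pr j \oL f.
Proof. by rewrite /ent pt1 // (lcomp1 LP). Qed.

Lemma ent_emb n m (f : 'I_n -> 'I_m) i j : ent (emb f) i j = ldelta L (f i) j.
Proof. by rewrite /ent -(lcompA LP) emb_pt // pr_pt. Qed.

(** The Kronecker product: points and projections at encoded pairs are themselves tensors, and the
    tensor of scalars is composition. *)
Lemma ent_tens n m n' m' (f : Hom L n m) (g : Hom L n' m') i i' j j' :
  ent (tens f g) (coV (i, i')) (coV (j, j')) = ent f i j \oL ent g i' j'.
Proof.
rewrite /ent; have -> : pr (coV (j, j')) = tens (pr j) (pr j') :> Hom L _ (1 * 1).
  apply: (pt_inj LP) => c; rewrite -[c]coK; case: (co c) => a b.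
  rewrite pr_pt tens_coV !pr_pt tens_scalar /ldelta (can_eq (@coVK _ _)).
  rewrite xpair_eqE; do 2 case: eqP => _ /=;
    by rewrite ?(lcomp1 LP) ?(lcomp1l LP) ?lzeror.
rewrite -tens_scalar -!(lcompA LP) tens_coV.
symmetry; exact: (tensM SP (pr j) (f \oL pt i) (pr j') (g \oL pt i')).
Qed.

Lemma ent_scalar (x : Hom L 1 1) : ent x ord0 ord0 = x.
Proof.
rewrite ent_scalarr -[pr ord0](lcomp1 LP) -{1}(pt1 LP) pr_pt /ldelta eqxx.
by rewrite (lcomp1l LP).
Qed.

(** * Applying a semiring endomorphism of the scalars to all entries *)

Section Entrywise.
Variable z : Hom L 1 1 -> Hom L 1 1.
Hypothesis z1 : z (lid 1) = lid 1.
Hypothesis z0 : z (lzero 1 1) = lzero 1 1.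
Hypothesis zD : forall x y, z (ladd x y) = ladd (z x) (z y).
Hypothesis zM : forall x y, z (x \oL y) = z x \oL z y.

(** A row times a column is the sum of the products of their entries, and [z] is additive, so the
    comparison is made term by term. The sum stays implicit: the induction splits off one summand
    with [copair_pair]. *)
Lemma scalar_product n (f f' : Hom L 1 n) (g g' : Hom L n 1) :
  (forall i, (g' \oL pt i) \oL (pr i \oL f') = z ((g \oL pt i) \oL (pr i \oL f))) ->
  g' \oL f' = z (g \oL f).
Proof.
elim: n f f' g g' => [|n IHn] f f' g g' e.
  by rewrite !(ltermP BP f) (ltermP BP f') (linitP LP g) (linitP LP g') z0.
have pE (h : Hom L 1 n.+1) : h = @pair L 1 n 1 (pr ord0 \oL h) (pi2 1 n \oL h).
  by rewrite pr_ord0; exact: (pairP BP (h : Hom L 1 (1 + n))).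
have cE (h : Hom L n.+1 1) : h = @copair L 1 n 1 (h \oL pt ord0) (h \oL kap2 1 n).
  by rewrite pt_ord0; exact: (copairP LP (h : Hom L (1 + n) 1)).
have cpE (h1 : Hom L 1 1) (h2 : Hom L n 1) (k1 : Hom L 1 1) (k2 : Hom L 1 n) :
    (@copair L 1 n 1 h1 h2 : Hom L n.+1 1) \oL (@pair L 1 n 1 k1 k2 : Hom L 1 n.+1)
    = ladd (h1 \oL k1) (h2 \oL k2) by exact: (copair_pair h1 h2 k1 k2).
rewrite (pE f) (pE f') (cE g) (cE g') !cpE zD; congr ladd; first exact: e.
apply: IHn => i; rewrite -!(lcompA LP).
have := e (lift ord0 i); rewrite !pt_lift // !pr_lift -!(lcompA LP); apply.
Qed.

Definition mapent n m (f : Hom L n m) : Hom L n m := ofmx (fun i j => z (ent f i j)).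

(** Every dagger has this form, with [z] its restriction to scalars; see [dag_trmapent]. *)
Definition trmapent n m (f : Hom L n m) : Hom L m n :=
  ofmx (fun j i => z (ent f i j)).

Lemma ent_mapent n m (f : Hom L n m) i j : ent (mapent f) i j = z (ent f i j).
Proof. exact: ent_ofmx. Qed.

Lemma ent_trmapent n m (f : Hom L n m) i j : ent (trmapent f) j i = z (ent f i j).
Proof. exact: ent_ofmx. Qed.

Lemma mapent_scalar x : mapent x = z x.
Proof.
by apply: ent_inj => a b; rewrite (ord1 a) (ord1 b) ent_mapent !ent_scalar.
Qed.

Lemma trmapent_scalar x : trmapent x = z x.
Proof.
by apply: ent_inj => a b; rewrite (ord1 a) (ord1 b) ent_trmapent !ent_scalar.
Qed.

Lemma z_ldelta n (i j : 'I_n) : z (ldelta L i j) = ldelta L i j.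
Proof. by rewrite /ldelta; case: eqP. Qed.

Lemma mapent_emb n m (f : 'I_n -> 'I_m) : mapent (emb f) = emb f.
Proof. by apply: ent_inj => i j; rewrite ent_mapent !ent_emb z_ldelta. Qed.

Lemma mapent_comp n m k (g : Hom L m k) (f : Hom L n m) :
  mapent (g \oL f) = mapent g \oL mapent f.
Proof.
apply: ent_inj => i j; rewrite ent_mapent.
have entE l (h : Hom L l k) (h' : Hom L n l) :
    ent (h \oL h') i j = (pr j \oL h) \oL (h' \oL pt i).
  by rewrite /ent -!(lcompA LP).
rewrite !entE; symmetry; apply: scalar_product => a.
by rewrite !(lcompA LP (pr a)) zM -!/(ent _ _ _) !ent_mapent.
Qed.

Lemma trmapent_emb n m (f : 'I_n -> 'I_m) (f' : 'I_m -> 'I_n) :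
  cancel f f' -> cancel f' f -> trmapent (emb f) = emb f'.
Proof.
move=> fK f'K; apply: ent_inj => i j; rewrite ent_trmapent !ent_emb z_ldelta.
by rewrite /ldelta (can2_eq fK f'K) eq_sym.
Qed.

Lemma trmapent_comp n m k (g : Hom L m k) (f : Hom L n m) :
  trmapent (g \oL f) = trmapent f \oL trmapent g.
Proof.
apply: ent_inj => j i; rewrite ent_trmapent.
have entE l (h : Hom L l k) (h' : Hom L n l) :
    ent (h \oL h') i j = (pr j \oL h) \oL (h' \oL pt i).
  by rewrite /ent -!(lcompA LP).
have entE' l (h : Hom L l n) (h' : Hom L k l) :
    ent (h \oL h') j i = (pr i \oL h) \oL (h' \oL pt j).
  by rewrite /ent -!(lcompA LP).
rewrite entE entE'; symmetry; apply: scalar_product => a.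
(* Transposing reverses the two factors of each product, and commutativity of scalars restores their
   order. *)
by rewrite !(lcompA LP (pr a)) zM -!/(ent _ _ _) !ent_trmapent scalarC.
Qed.

Hypothesis zK : involutive z.

Lemma mapentK n m (f : Hom L n m) : mapent (mapent f) = f.
Proof. by apply: ent_inj => i j; rewrite !ent_mapent zK. Qed.

(** The coherence isomorphisms come from bijections, and the transpose of a permutation matrix,
    whose entries [z] fixes, is its inverse. Projections and coprojections are likewise transposed
    matrices of zeros and ones. *)
Lemma trmapent_dagger : is_dagger trmapent.
Proof.
have inv n m (f : 'I_n -> 'I_m) (f' : 'I_m -> 'I_n) :
    cancel f f' -> cancel f' f ->
    is_inverse (emb f : Hom L n m) (trmapent (emb f)).
  move=> fK f'K; rewrite (trmapent_emb fK f'K); split; rewrite -(embM LP).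
    by rewrite -(emb1 LP); congr emb; apply: funext.
  by rewrite -(emb1 LP); congr emb; apply: funext.
split.
- by move=> n; rewrite -(emb1 LP); apply: trmapent_emb.
- exact: trmapent_comp.
- by move=> n m f; apply: ent_inj => i j; rewrite !ent_trmapent zK.
- move=> n m n' m' f g; apply: ent_inj => c d; rewrite ent_trmapent.
  rewrite -[c]coK -[d]coK; case: (co c) (co d) => [a b] [a' b'].
  by rewrite !ent_tens !ent_trmapent zM.
- move=> n m k; rewrite -(emb_alpha EP).
  apply: (inv _ _ _ (fun c =>
    coV ((co (co c).1).1, coV ((co (co c).1).2, (co c).2)))).
    move=> c; rewrite -[c]coK; case: (co c) => a d; rewrite -[d]coK.
    by case: (co d) => b e; rewrite /oalpha ?coVK /= ?coVK /= ?coVK.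
  move=> c; rewrite -[c]coK; case: (co c) => d e; rewrite -[d]coK.
  by case: (co d) => a b; rewrite /oalpha ?coVK /= ?coVK /= ?coVK.
- move=> n; rewrite -(emb_rho EP); apply: (inv _ _ _ (fun a => coV (a, ord0))).
    move=> c; rewrite /orho -[RHS]coK; congr coV.
    by case: (co c) => a b; rewrite (ord1 b).
  by move=> c; rewrite /orho coVK.
- move=> n m; rewrite -(emb_gam EP); apply: (inv _ _ _ (@ogam m n)) => c;
    by rewrite -[c]coK; case: (co c) => a b; rewrite /ogam !coVK.
- move=> n m; apply: ent_inj => i j; rewrite ent_trmapent /kap1 ent_emb.
  rewrite /ent -[j]splitK; case: (fintype.split j) => b /=.
    rewrite -(lcompA LP) -emb_pt // (lcompA LP (pi1 n m)) (pi1_kap1 BP).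
    by rewrite (lcomp1l LP) pr_pt z_ldelta /ldelta eq_lshift eq_sym.
  rewrite -(lcompA LP) -emb_pt // (lcompA LP (pi1 n m)) (pi1_kap2 BP).
  by rewrite lzeror lzerol /ldelta eq_lrshift.
- move=> n m; apply: ent_inj => i j; rewrite ent_trmapent /kap2 ent_emb.
  rewrite /ent -[j]splitK; case: (fintype.split j) => b /=.
    rewrite -(lcompA LP) -emb_pt // (lcompA LP (pi2 n m)) (pi2_kap1 BP).
    by rewrite lzeror lzerol /ldelta eq_rlshift.
  rewrite -(lcompA LP) -emb_pt // (lcompA LP (pi2 n m)) (pi2_kap2 BP).
  by rewrite (lcomp1l LP) pr_pt z_ldelta /ldelta eq_rshift eq_sym.
Qed.

End Entrywise.
End Matrix.

(** * The monad of a theory *)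

Section TLQuotient.
Variable L : smb_data.
Implicit Types X Y : Sets.

Lemma cls_emb X i m (f : 'I_i -> 'I_m) (g : Hom L 1 i) (v : 'I_m -> X) :
  cls (emb f \oL g) v = cls g (v \o f).
Proof. by apply/eqmodP/asboolP; apply: rst_step; constructor. Qed.

Lemma cls_surj X (t : TL L X) :
  exists i (g : Hom L 1 i) (v : 'I_i -> X), t = cls g v.
Proof.
case e: (repr t) => [i [g v]]; exists i, g, v.
by rewrite -[t]reprK e.
Qed.

(** Chooses representatives of the inner classes, which brings [t] into the form to which the
    formula [TL_mu] applies. *)
Lemma cls_cls_surj X (t : TL L (TL L X)) :
  exists i (g : Hom L 1 i) (j : 'I_i -> nat) (g_ : forall a, Hom L 1 (j a))
    (v_ : forall a, 'I_(j a) -> X), t = cls g (fun a => cls (g_ a) (v_ a)).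
Proof.
case: (cls_surj t) => i [g [w ->]]; exists i, g.
pose x a : TLpre L X := repr (w a).
exists (fun a => projT1 (x a)), (fun a => (projT2 (x a)).1),
  (fun a => (projT2 (x a)).2).
congr cls; apply: funext => a; rewrite -[LHS]reprK /x.
by case: (repr (w a)) => k [].
Qed.

(** Evaluates [F] at the chosen representative, whether or not [F] respects the relation;
    [TLlift_cls] makes it independent of that choice when [F] is invariant under one generating
    step. *)
Definition TLlift X (Y : Type) (F : forall i, Hom L 1 i -> ('I_i -> X) -> Y)
    (t : TL L X) : Y :=
  let x : TLpre L X := repr t in F (projT1 x) (projT2 x).1 (projT2 x).2.

Lemma TLlift_cls X (Y : Type) (F : forall i, Hom L 1 i -> ('I_i -> X) -> Y) :
  (forall i m (f : 'I_i -> 'I_m) g v, F m (emb f \oL g) v = F i g (v \o f)) ->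
  forall i (g : Hom L 1 i) (v : 'I_i -> X), TLlift F (cls g v) = F i g v.
Proof.
move=> FP; pose F' (x : TLpre L X) := F (projT1 x) (projT2 x).1 (projT2 x).2.
have F'P x y : clos_refl_sym_trans _ (@TLstep L X) x y -> F' x = F' y.
  by elim=> {x y} [_ _ [i m f g v]|x|x y _ ->|x y z _ -> _ ->] //; apply: FP.
move=> i g v; apply: (F'P _ (TLin g v)); apply/asboolP.
by apply/(@eqmodP _ (TLequiv L X)); rewrite reprK.
Qed.

End TLQuotient.

Lemma inj_surj_bij (A B : Type) (f : A -> B) :
  injective f -> (forall b, exists a, f a = b) -> bijective f.
Proof.
move=> f_inj f_surj; have [g gK] := choice f_surj.
by exists g => // a; apply: f_inj.
Qed.

(** * Monad laws, commutativity and additivity of T_L *)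

Section TLMonad.
Variable L : SMBLaw_ob.
Let BP := smb_biprod (smbP L).
Let LP := smb_lawvere (smbP L).
Implicit Types X Y Z : Sets.
Local Notation pt := (@pt L _).

Definition ext X n (t : TL L X) (q : X -> Hom L 1 n) : Hom L 1 n :=
  TLlift (fun i g v => cotuple (q \o v) \oL g) t.

Lemma ext_cls X n i (g : Hom L 1 i) (v : 'I_i -> X) (q : X -> Hom L 1 n) :
  ext (cls g v) q = cotuple (q \o v) \oL g.
Proof.
rewrite /ext TLlift_cls // => {}i m f {}g {}v.
by rewrite (lcompA LP) cotuple_emb.
Qed.

Lemma ext_inj X (t s : TL L X) :
  (forall n (q : X -> Hom L 1 n), ext t q = ext s q) -> t = s.
Proof.
case: (cls_surj t) (cls_surj s) => i [g [v ->]] [j [h [w ->]]] e.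
(* An empty [X] offers no default element for [nth], but it forces both arities to be 0. *)
have [[y0 _]|noX] := pselect (exists x : X, True); last first.
  have i0 : i = 0 by case: i g v e => // i g v _; case: noX; exists (v ord0).
  have j0 : j = 0 by case: j h w {e} => // j h w; case: noX; exists (w ord0).
  subst i j; rewrite (ltermP BP g) (ltermP BP h); congr cls.
  by apply: funext; case.
pose U : seq {classic X} :=
  codom (v : 'I_i -> {classic X}) ++ codom (w : 'I_j -> {classic X}).
(* [index] returns [size U] outside [U], hence the successor. The test function is [pt] after [p];
   since [r] inverts [p] on [U], the values of [v] and [w] can be recovered from their indices. *)
pose p (x : X) : 'I_(size U).+1 := inord (index (x : {classic X}) U).
pose r (k : 'I_(size U).+1) : X := nth (y0 : {classic X}) U k.
have pK (x : {classic X}) : x \in U -> r (p x) = x.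
  by move=> xU; rewrite /r /p inordK ?nth_index // ltnS index_size.
have vE : v = r \o (p \o v).
  by apply: funext => a /=; rewrite pK // mem_cat codom_f.
have wE : w = r \o (p \o w).
  by apply: funext => a /=; rewrite pK // mem_cat codom_f orbT.
rewrite vE wE -!cls_emb; congr cls.
have := e _ (fun x => pt (p x)); rewrite !ext_cls.
rewrite -[_ \o v]/(fun a => pt ((p \o v) a)).
by rewrite -[_ \o w]/(fun a => pt ((p \o w) a)) !embE.
Qed.

Definition TLmap X Y (h : X -> Y) : TL L X -> TL L Y :=
  TLlift (fun i g v => cls g (h \o v)).

Definition TLeta X (x : X) : TL L X := cls (lid 1) (fun=> x).

Definition TLmu X : TL L (TL L X) -> TL L X :=
  TLlift (fun i g (w : 'I_i -> TL L X) =>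
    let x a : TLpre L X := repr (w a) in
    cls (summap (fun a => (projT2 (x a)).1) \oL g)
        (fun c => (projT2 (x (tagnat.sig1 c))).2 (tagnat.sig2 c))).

Definition TLops : monad_ops (TL L) := MonadOps TLmap TLeta TLmu.

Lemma TLmap_cls X Y (h : X -> Y) i (g : Hom L 1 i) v :
  TLmap h (cls g v) = cls g (h \o v).
Proof. by rewrite /TLmap TLlift_cls // => *; rewrite cls_emb. Qed.

(** The type of [tagnat.sig2] depends on [tagnat.sig1], so the two are rewritten together, as one
    dependent pair under [F]. *)
Lemma sig_Rank X i (j : 'I_i -> nat) (v_ : forall a, 'I_(j a) -> X) a b :
  v_ (tagnat.sig1 (tagnat.Rank a b)) (tagnat.sig2 (tagnat.Rank a b)) = v_ a b.
Proof.
pose F (s : {a : 'I_i & 'I_(j a)}) := v_ (tag s) (tagged s).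
by rewrite -[LHS]/(F (tagnat.sig (tagnat.Rank a b))) tagnat.rankK.
Qed.

Lemma cotuple_summap X n i (j : 'I_i -> nat) (g_ : forall a, Hom L 1 (j a))
    (v_ : forall a, 'I_(j a) -> X) (q : X -> Hom L 1 n) :
  cotuple (q \o (fun c => v_ (tagnat.sig1 c) (tagnat.sig2 c))) \oL summap g_ =
  cotuple (fun a => ext (cls (g_ a) (v_ a)) q).
Proof.
rewrite /summap comp_cotuple //; congr cotuple; apply: funext => a.
rewrite (lcompA LP) cotuple_emb // ext_cls; congr (cotuple _ \oL _).
by apply: funext => b; rewrite /= sig_Rank.
Qed.

Lemma ext_map X Y n (h : X -> Y) (t : TL L X) (q : Y -> Hom L 1 n) :
  ext (TLmap h t) q = ext t (q \o h).
Proof. by case: (cls_surj t) => i [g [v ->]]; rewrite TLmap_cls !ext_cls. Qed.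

Lemma ext_eta X n (x : X) (q : X -> Hom L 1 n) : ext (TLeta x) q = q x.
Proof.
rewrite ext_cls (lcomp1 LP) -[LHS](lcomp1 LP) -(pt1 LP).
by rewrite cotuple_pt.
Qed.

Lemma ext_mu X n (t : TL L (TL L X)) (q : X -> Hom L 1 n) :
  ext (TLmu t) q = ext t (fun s => ext s q).
Proof.
(* The body of [TLmu] is evaluated before it is known to respect the relation. The target and the
   function are general because [ext_inj] then deduces that invariance from this same formula. *)
have pre i (g : Hom L 1 i) (w : 'I_i -> TL L X) k (q' : X -> Hom L 1 k) :
    ext (let x a : TLpre L X := repr (w a) in
         cls (summap (fun a => (projT2 (x a)).1) \oL g)
           (fun c => (projT2 (x (tagnat.sig1 c))).2 (tagnat.sig2 c))) q' =
    cotuple (fun a => ext (w a) q') \oL g.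
  rewrite /= ext_cls (lcompA LP).
  rewrite (cotuple_summap _ (fun a => (projT2 (repr (w a) : TLpre L X)).2)).
  congr (cotuple _ \oL _); apply: funext => a; congr ext.
  by rewrite -[RHS]reprK; case: (repr (w a)) => ? [].
case: (cls_surj t) => i [g [w ->]]; rewrite /TLmu TLlift_cls.
  by rewrite pre ext_cls.
move=> {}i m f {}g {}w; apply: ext_inj => k q'; rewrite !pre (lcompA LP).
by rewrite cotuple_emb.
Qed.

Lemma TLops_TL : is_TL_ops TLops.
Proof.
split=> //; first by move=> *; apply: TLmap_cls.
move=> X i g j g_ v_; apply: ext_inj => n q; rewrite ext_mu !ext_cls (lcompA LP).
by rewrite cotuple_summap.
Qed.

Lemma TLops_monad : is_monad TLops.
Proof.
split; rewrite /=.
- by move=> X t; apply: ext_inj => n q; rewrite ext_map.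
- by move=> X Y Z g f t; apply: ext_inj => n q; rewrite /= !ext_map.
- by move=> X Y f t; apply: ext_inj => n q; rewrite /= ext_map !ext_eta.
- move=> X Y f t; apply: ext_inj => n q; rewrite /= ext_map !ext_mu ext_map.
  by congr ext; apply: funext => s /=; rewrite ext_map.
- by move=> X t; apply: ext_inj => n q; rewrite /= ext_mu ext_eta.
- move=> X t; apply: ext_inj => n q; rewrite /= ext_mu ext_map.
  by congr ext; apply: funext => s /=; rewrite ext_eta.
- move=> X t; apply: ext_inj => n q; rewrite /= !ext_mu ext_map.
  by congr ext; apply: funext => s /=; rewrite ext_mu.
Qed.

(** Both sides equal one map out of [tens g h], whose two expansions [tens_scalarr] and
    [tens_scalarl] evaluate the arguments in the two orders. *)
Lemma ext_exchange X Y n (t : TL L X) (s : TL L Y) (q : X -> Y -> Hom L 1 n) :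
  ext t (fun x => ext s (q x)) = ext s (fun y => ext t (fun x => q x y)).
Proof.
case: (cls_surj t) (cls_surj s) => i [g [v ->]] [j [h [w ->]]].
pose Q : Hom L (i * j) n := cotuple (fun c => q (v (co c).1) (w (co c).2)).
transitivity (Q \oL tens g h : Hom L (1 * 1) n); rewrite !ext_cls.
  rewrite tens_scalarr (lcompA LP) comp_cotuple //; congr (cotuple _ \oL _).
  apply: funext => a /=; rewrite ext_cls (lcompA LP) cotuple_emb //.
  by congr (cotuple _ \oL _); apply: funext => b; rewrite /comp coVK.
rewrite tens_scalarl (lcompA LP) comp_cotuple //; congr (cotuple _ \oL _).
apply: funext => b /=; rewrite ext_cls (lcompA LP) cotuple_emb //.
by congr (cotuple _ \oL _); apply: funext => a; rewrite /comp coVK.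
Qed.

Lemma TLops_comm : is_commutative TLops.
Proof.
move=> X Y [t s]; apply: ext_inj => n q; rewrite /dst /st' /st /=.
rewrite !ext_mu !ext_map /=.
transitivity (ext t (fun x => ext s (fun y => q (x, y)))).
  by congr ext; apply: funext => x /=; rewrite !ext_map.
rewrite (ext_exchange t s (fun x y => q (x, y))).
by congr ext; apply: funext => y /=; rewrite !ext_map.
Qed.

Lemma TL_void (t s : TL L void) : t = s.
Proof.
case: (cls_surj t) (cls_surj s) => i [g [v ->]] [j [h [w ->]]].
have i0 : i = 0 by case: i g v => // i g v; case: (v ord0).
have j0 : j = 0 by case: j h w => // j h w; case: (w ord0).
subst i j; rewrite (ltermP BP g) (ltermP BP h); congr cls.
by apply: funext; case.
Qed.

Definition TLzero0 (_ : unit) : TL L void := cls (lterm 1) (@from0 void).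

Lemma ext_zmap X Y n (x : X) (q : Y -> Hom L 1 n) :
  ext (zmap TLops TLzero0 Y x) q = lzero 1 n.
Proof. by rewrite /zmap /= TLmap_cls ext_cls. Qed.

Lemma ext_add X n (t : TL L X) (q q' : X -> Hom L 1 n) :
  ext t (fun x => ladd (q x) (q' x)) = ladd (ext t q) (ext t q').
Proof.
case: (cls_surj t) => i [g [v ->]]; rewrite !ext_cls -ladd_comp; congr lcomp.
by apply: (pt_inj LP) => a; rewrite ladd_comp !cotuple_pt.
Qed.

Definition sumfun X Y Z (f : X -> Z) (g : Y -> Z) (u : X + Y) : Z :=
  match u with inl x => f x | inr y => g y end.

Lemma ext_bc1 X Y n (t : TL L (X + Y)%type) (q : X -> Hom L 1 n) :
  ext (bc TLops TLzero0 t).1 q = ext t (sumfun q (fun=> lzero 1 n)).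
Proof.
rewrite /bc /= ext_mu ext_map; congr ext; apply: funext => -[x|y] /=.
  by rewrite ext_eta.
by rewrite (ext_zmap y).
Qed.

Lemma ext_bc2 X Y n (t : TL L (X + Y)%type) (q : Y -> Hom L 1 n) :
  ext (bc TLops TLzero0 t).2 q = ext t (sumfun (fun=> lzero 1 n) q).
Proof.
rewrite /bc /= ext_mu ext_map; congr ext; apply: funext => -[x|y] /=.
  by rewrite (ext_zmap x).
by rewrite ext_eta.
Qed.

Lemma TLops_additive : is_additive TLops.
Proof.
exists TLzero0; split.
  by exists (fun=> tt) => [[]|t] //; apply: TL_void.
move=> X Y; apply: inj_surj_bij => [t s e|[t s]].
  apply: ext_inj => n q.
  pose q1 x := q (inl x); pose q2 y := q (inr y).
  (* Injectivity: [q] is the sum of its restrictions to the two summands, each extended by zero, and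
     the extensions of these see only the two components of [bc]. *)
  have -> : q = (fun u => ladd (sumfun q1 (fun=> lzero 1 n) u)
                              (sumfun (fun=> lzero 1 n) q2 u)).
    by apply: funext => -[x|y] /=; rewrite ?ladd0r ?ladd0l.
  by rewrite !ext_add -!ext_bc1 -!ext_bc2 e.
case: (cls_surj t) (cls_surj s) => i [g [v ->]] [j [h [w ->]]].
(* Surjectivity: the preimage pairs the operations and places the variables side by side. *)
exists (cls (pair g h) (fun c => match fintype.split c with
                           | inl a => inl (v a) | inr b => inr (w b) end)).
have zeroE k n (f : Hom L 1 k) : cotuple (fun=> lzero 1 n) \oL f = lzero 1 n.
  rewrite -[RHS](lzeror _ f); congr lcomp.
  by apply: (pt_inj LP) => a; rewrite cotuple_pt // lzeror.
pose vw : 'I_(i + j) -> X + Y := fun c => match fintype.split c with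
  | inl a => inl (v a) | inr b => inr (w b) end.
have vwE (Z : Type) (f : X + Y -> Z) :
    (f \o vw \o @lshift i j = f \o inl \o v) *
    (f \o vw \o @rshift i j = f \o inr \o w).
  split; apply: funext => a; rewrite /comp /vw.
    by rewrite -[lshift _ _]/(unsplit (inl a)) unsplitK.
  by rewrite -[rshift _ _]/(unsplit (inr a)) unsplitK.
apply: injective_projections; apply: ext_inj => n q /=.
  rewrite ext_bc1 !ext_cls cotuple_copair // copair_pair !vwE.
  by rewrite zeroE ladd0r.
rewrite ext_bc2 !ext_cls cotuple_copair // copair_pair !vwE.
by rewrite zeroE ladd0l.
Qed.

Lemma TLops_ACMnd : is_ACMnd TLops.
Proof.
by split; [apply: TLops_monad | apply: TLops_comm | apply: TLops_additive].
Qed.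

End TLMonad.

(** * The Kleisli theory of a monad *)

Section Bind.
Variables (T : Sets -> Sets) (M : monad_ops T) (MP : is_monad M).
Implicit Types X Y Z : Sets.

Definition bind X Y (t : T X) (f : X -> T Y) : T Y := mmu M (mmap M f t).

Lemma eq_bind X Y (t : T X) (f g : X -> T Y) : f =1 g -> bind t f = bind t g.
Proof. by move=> e; congr bind; apply: funext. Qed.

Lemma bind_eta X Y (x : X) (f : X -> T Y) : bind (meta M x) f = f x.
Proof.
have /= e := meta_nat MP f x.
by rewrite /bind -e; apply: (mmu_eta MP).
Qed.

Lemma eta_bind X (t : T X) : bind t (meta M) = t.
Proof. exact: mmu_map_eta. Qed.

Lemma mmapE X Y (f : X -> Y) (t : T X) : mmap M f t = bind t (meta M \o f).
Proof.
by rewrite /bind (mmap_comp MP); have /= -> := mmu_map_eta MP (mmap M f t).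
Qed.

Lemma bind_bind X Y Z (t : T X) (f : X -> T Y) (g : Y -> T Z) :
  bind (bind t f) g = bind t (fun x => bind (f x) g).
Proof.
rewrite {1 2}/bind; have /= <- := mmu_nat MP g (mmap M f t).
have /= <- := mmu_mu MP (mmap M (mmap M g) (mmap M f t)).
have /= <- := mmap_comp MP (mmap M g) f t.
by have /= <- := mmap_comp MP (mmu M (X:=Z)) (mmap M g \o f) t.
Qed.

Lemma bind_map X Y Z (t : T X) (f : X -> Y) (g : Y -> T Z) :
  bind (mmap M f t) g = bind t (g \o f).
Proof. by rewrite mmapE bind_bind; apply: eq_bind => x; apply: bind_eta. Qed.

Lemma map_bind X Y Z (t : T X) (f : X -> T Y) (g : Y -> Z) :
  mmap M g (bind t f) = bind t (fun x => mmap M g (f x)).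
Proof. by rewrite mmapE bind_bind; apply: eq_bind => x; rewrite mmapE. Qed.

Lemma map_eta X Y (f : X -> Y) x : mmap M f (meta M x) = meta M (f x).
Proof. by rewrite mmapE bind_eta. Qed.

Lemma dstE X Y (t : T X) (s : T Y) :
  dst M (t, s) = bind t (fun x => bind s (fun y => meta M (x, y))).
Proof.
rewrite /dst /st /= -[LHS]/(bind _ _) bind_map; apply: eq_bind => x.
by rewrite /st' /st /= !mmapE bind_bind; apply: eq_bind => y; rewrite bind_eta.
Qed.

Hypothesis MC : is_commutative M.

(** Commutativity is the case where [k] returns the pair; binding both sides with the uncurried [k]
    gives the rest. *)
Lemma exchange X Y Z (t : T X) (s : T Y) (k : X -> Y -> T Z) :
  bind t (fun x => bind s (k x)) = bind s (fun y => bind t (k ^~ y)).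
Proof.
have dstE' : dst M (t, s) = bind s (fun y => bind t (fun x => meta M (x, y))).
  rewrite MC /= -[LHS]/(bind _ _) /st' /st /= bind_map bind_map.
  by apply: eq_bind => y; rewrite /= mmapE.
have := dstE'; rewrite dstE => /(congr1 (fun u => bind u (fun p => k p.1 p.2))).
rewrite !bind_bind => e; transitivity (bind t (fun x =>
   bind (bind s (fun y => meta M (x, y))) (fun p => k p.1 p.2))).
  by apply: eq_bind => x; rewrite bind_bind; apply: eq_bind => y; rewrite bind_eta.
rewrite e; apply: eq_bind => y; rewrite bind_bind.
by apply: eq_bind => x; rewrite bind_eta.
Qed.

End Bind.

Lemma oalpha_coV n m k (x : 'I_n) (y : 'I_m) (z : 'I_k) :
  oalpha (coV (x, coV (y, z))) = coV (coV (x, y), z).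
Proof. by rewrite /oalpha !coVK. Qed.

Lemma otens_coV n m n' m' (f : 'I_n -> 'I_m) (g : 'I_n' -> 'I_m') x y :
  otens f g (coV (x, y)) = coV (f x, g y).
Proof. by rewrite /otens coVK. Qed.

Lemma ogam_coV n m (x : 'I_n) (y : 'I_m) : ogam (coV (x, y)) = coV (y, x).
Proof. by rewrite /ogam coVK. Qed.

Lemma olam_coV n x (y : 'I_n) : olam (coV (x, y)) = y.
Proof. by rewrite /olam coVK. Qed.

Lemma orho_coV n (x : 'I_n) y : orho (coV (x, y)) = x.
Proof. by rewrite /orho coVK. Qed.

Definition ocoE := (oalpha_coV, otens_coV, ogam_coV, olam_coV, orho_coV).

(** * Coproducts and tensor of the Kleisli theory *)

Section KleisliLaw.
Variable T : ACMnd_ob.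
Let TP := acm_monad (acmP T).
Let TC := acm_comm (acmP T).
Local Notation bind := (bind T).
Local Notation K := (Kl_smb T).
Implicit Types n m k l : nat.

Lemma Kl_compE n m k (g : Hom K m k) (f : Hom K n m) c :
  (g \oL f) c = bind (f c) g.
Proof. by []. Qed.

Lemma Kl_tensE n m n' m' (f : Hom K n m) (g : Hom K n' m') c :
  tens f g c =
  bind (f (co c).1) (fun x => bind (g (co c).2) (fun y => meta T (coV (x, y)))).
Proof.
rewrite -[LHS]/(mmap T (@coV _ _) (dst T (f (co c).1, g (co c).2))).
rewrite dstE // map_bind //; apply: eq_bind => x; rewrite map_bind //.
by apply: eq_bind => y; rewrite map_eta.
Qed.

Lemma bind_tens n m n' m' (X : Sets) (f : Hom K n m) (g : Hom K n' m') c
    (h : 'I_(m * m') -> T X) :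
  bind (tens f g c) h =
  bind (f (co c).1) (fun x => bind (g (co c).2) (fun y => h (coV (x, y)))).
Proof.
rewrite Kl_tensE bind_bind //; apply: eq_bind => x; rewrite bind_bind //.
by apply: eq_bind => y; rewrite bind_eta.
Qed.

Lemma Kl_comp_emb n m k (g : Hom K m k) (f : 'I_n -> 'I_m) c :
  (g \oL emb f) c = g (f c).
Proof. exact: bind_eta. Qed.

Lemma Kl_lawvere : is_Lawvere K.
Proof.
split=> //=.
- by move=> n m f; apply: funext => c; apply: bind_eta.
- by move=> n m f; apply: funext => c; apply: eta_bind.
- move=> n m k l h g f; apply: funext => c.
  by rewrite /= /Kl_comp /= -!/(bind _ _) bind_bind.
- by move=> n m k g f; apply: funext => c; rewrite [RHS]Kl_comp_emb.
- by move=> n f; apply: funext; case.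
- move=> n m k f g; apply: funext => c; rewrite [LHS]Kl_comp_emb /=.
  by rewrite -[lshift _ _]/(unsplit (inl c)) unsplitK.
- move=> n m k f g; apply: funext => c; rewrite [LHS]Kl_comp_emb /=.
  by rewrite -[rshift _ _]/(unsplit (inr c)) unsplitK.
- move=> n m k h; apply: funext => c; rewrite -[c in LHS]splitK.
  by case: (fintype.split c) => a; rewrite [RHS]Kl_comp_emb.
Qed.

Let KL := Kl_lawvere.

Lemma Kl_emb_tens n m n' m' (f : 'I_n -> 'I_m) (g : 'I_n' -> 'I_m') :
  emb (otens f g) = tens (emb f) (emb g) :> Hom K _ _.
Proof. by apply: funext => c; rewrite Kl_tensE !bind_eta. Qed.

Lemma Kl_emb_strict : emb_strict K.
Proof. by split=> //; apply: Kl_emb_tens. Qed.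

Lemma Kl_emb_inverse n m (f : 'I_n -> 'I_m) (f' : 'I_m -> 'I_n) :
  cancel f f' -> cancel f' f -> is_inverse (emb f : Hom K n m) (emb f').
Proof.
by move=> fK f'K; split; rewrite -embM // -emb1 //; congr emb; apply: funext.
Qed.

Let KE := Kl_emb_strict.

(** Functoriality of the tensor and naturality of [gam] need [exchange], that is, commutativity of
    the monad. The coherence diagrams are images of equations between functions, compared on nested
    encoded pairs. *)
Lemma Kl_symmonoidal : is_symmonoidal K.
Proof.
split.
- move=> n m; rewrite -!(emb1 KL) -Kl_emb_tens; congr emb.
  by apply: funext => c; rewrite /otens -surjective_pairing coK.
- move=> n m k n' m' k' g f g' f'; apply: funext => c.
  rewrite [RHS]Kl_compE bind_tens Kl_tensE Kl_compE bind_bind //.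
  apply: eq_bind => x; under eq_bind => z do rewrite Kl_compE bind_bind //.
  rewrite exchange //; apply: eq_bind => y; rewrite Kl_tensE coVK.
  by [].
- move=> n m n' m' n'' m'' f g h; apply: funext => c.
  rewrite [LHS]Kl_compE bind_tens [RHS]Kl_comp_emb [in RHS]Kl_tensE /oalpha !coVK.
  rewrite bind_tens coVK; apply: eq_bind => x; rewrite bind_tens.
  by apply: eq_bind => y; apply: eq_bind => z; rewrite /alpha /= /oalpha !coVK.
- move=> n m f; apply: funext => c.
  rewrite [LHS]Kl_compE bind_tens bind_eta // [RHS]Kl_comp_emb.
  rewrite -[RHS](eta_bind TP); apply: eq_bind => y.
  by rewrite /lam /= /olam coVK.
- move=> n m f; apply: funext => c.
  rewrite [LHS]Kl_compE bind_tens [RHS]Kl_comp_emb.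
  rewrite -[RHS](eta_bind TP); apply: eq_bind => y.
  by rewrite bind_eta // /rho /= /orho coVK.
- move=> n m n' m' f g; apply: funext => c.
  rewrite [LHS]Kl_compE bind_tens [RHS]Kl_comp_emb [in RHS]Kl_tensE /ogam coVK.
  rewrite exchange //; apply: eq_bind => x; apply: eq_bind => y.
  by rewrite /gam /= /ogam coVK.
- move=> n m k; rewrite -(emb_alpha KE).
  exists (emb (fun c => coV ((co (co c).1).1, coV ((co (co c).1).2, (co c).2)))).
  apply: Kl_emb_inverse => c; rewrite -[c]coK; case: (co c) => x y.
    by rewrite -[y]coK; case: (co y) => u v; rewrite ocoE !coVK.
  by rewrite -[x]coK; case: (co x) => u v; rewrite !coVK ocoE.
- move=> n; rewrite -(emb_lam KE); exists (emb (fun a => coV (ord0, a))).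
  apply: Kl_emb_inverse => c; last by rewrite /olam coVK.
  by rewrite -[c]coK; case: (co c) => x y; rewrite /olam coVK [x]ord1.
- move=> n; rewrite -(emb_rho KE); exists (emb (fun a => coV (a, ord0))).
  apply: Kl_emb_inverse => c; last by rewrite /orho coVK.
  by rewrite -[c]coK; case: (co c) => x y; rewrite /orho coVK [y]ord1.
- move=> n m; rewrite -!(emb_gam KE) -(embM KL) -(emb1 KL); congr emb.
  by apply: funext => c; rewrite -[c]coK; case: (co c) => x y; rewrite /comp !ocoE.
- move=> a b c d; rewrite -!(emb_alpha KE) -!(emb1 KL) -!(emb_tens KE) -!(embM KL).
  congr emb; apply: funext => i; rewrite -[i]coK; case: (co i) => x j.
  rewrite -[j]coK; case: (co j) => y k; rewrite -[k]coK; case: (co k) => z w.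
  by rewrite /comp !ocoE.
- move=> a b; rewrite -!(emb_alpha KE, emb_rho KE, emb_lam KE) -!(emb1 KL).
  rewrite -!(emb_tens KE) -!(embM KL).
  congr emb; apply: funext => i; rewrite -[i]coK; case: (co i) => x j.
  rewrite -[j]coK; case: (co j) => y k.
  by rewrite /comp !ocoE.
- move=> a b c; rewrite -!(emb_alpha KE, emb_gam KE) -!(emb1 KL).
  rewrite -!(emb_tens KE) -!(embM KL).
  congr emb; apply: funext => i; rewrite -[i]coK; case: (co i) => x j.
  rewrite -[j]coK; case: (co j) => y k.
  by rewrite /comp !ocoE.
- move=> n; rewrite -(emb_lam KE) -(emb_gam KE) -(emb_rho KE) -(embM KL).
  congr emb; apply: funext => c; rewrite -[c]coK; case: (co c) => x y.
  by rewrite /comp !ocoE.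
Qed.

End KleisliLaw.

(** * Biproducts and matrices in the Kleisli theory *)

Section KleisliBiproduct.
Variable T : ACMnd_ob.
Let TP := acm_monad (acmP T).
Local Notation bind := (bind T).
Local Notation K := (Kl_smb T).
Implicit Types n m k l : nat.
Implicit Types X Y : Sets.

Lemma iso0_bij : bijective (iso0 T).
Proof. exact: (svalP (cid (acm_add (acmP T)))).1. Qed.

Lemma bcK X Y (t : T (X + Y)%type) : bcV (bc T (iso0 T) t) = t.
Proof. exact: (svalP (cid (bij_ex _))).1. Qed.

Lemma bcVK X Y (p : T X * T Y) : bc T (iso0 T) (bcV p) = p.
Proof. exact: (svalP (cid (bij_ex _))).2. Qed.

Lemma bind_zero X Y Z (x : X) (f : Y -> T Z) :
  bind (zmap T (iso0 T) Y x) f = zmap T (iso0 T) Z x.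
Proof.
by rewrite /zmap bind_map // mmapE //; apply: eq_bind; case.
Qed.

(** The empty sets ['I_0] and [void] differ as types; [T 'I_0] is a retract of [T void], which has
    one element. *)
Lemma T_I0_eq (t s : T 'I_0) : t = s.
Proof.
have cancel0 (u : T 'I_0) : mmap T (of_void 'I_0) (mmap T (@from0 void) u) = u.
  have /= <- := mmap_comp TP (of_void 'I_0) (@from0 void) u.
  by rewrite -[RHS](mmap_id TP); congr mmap; apply: funext; case.
rewrite -[t]cancel0 -[s]cancel0; congr mmap.
by case: iso0_bij => g gK Kg; rewrite -[LHS]Kg -[RHS]Kg; case: (g _); case: (g _).
Qed.

Lemma Kl_zeroE n m (c : 'I_n) :
  (lzero n m : Hom K n m) c = zmap T (iso0 T) 'I_m c.
Proof. exact: bind_zero. Qed.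

(** Up to the bijection [unsplit], the components of [bc] are the composites with the two
    projections, and pairing is [bcV]. The inverse laws [bcVK] and [bcK] thus give the equations for
    pairing and its uniqueness. *)
Lemma Kl_biproduct : is_biproduct K.
Proof.
split.
- by move=> n f; apply: funext => c; apply: T_I0_eq.
- move=> n m k f g; apply: funext => c.
  rewrite [LHS]Kl_compE /= bind_map //.
  have := congr1 fst (bcVK (f c, g c)); rewrite /= -!/(bind _ _) => {2}<-.
  by apply: eq_bind => u /=; rewrite unsplitK.
- move=> n m k f g; apply: funext => c.
  rewrite [LHS]Kl_compE /= bind_map //.
  have := congr1 snd (bcVK (f c, g c)); rewrite /= -!/(bind _ _) => {2}<-.
  by apply: eq_bind => u /=; rewrite unsplitK.
- move=> n m k h; apply: funext => c.
  rewrite -[RHS]/(mmap T (@unsplit n m) (bcV (bind (h c) (pi1 n m : Hom K _ _),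
                                              bind (h c) (pi2 n m : Hom K _ _)))).
  pose t := mmap T (@fintype.split n m) (h c).
  have <- : bc T (iso0 T) t = (bind (h c) (pi1 n m : Hom K _ _),
                               bind (h c) (pi2 n m : Hom K _ _)).
    by rewrite /bc -!/(bind _ _) !bind_map.
  rewrite bcK /t.
  have /= <- := mmap_comp TP (@unsplit n m) (@fintype.split n m) (h c).
  rewrite -[LHS](mmap_id TP); congr mmap.
  by apply: funext => a /=; rewrite splitK.
- move=> n m; apply: funext => c; rewrite [LHS]Kl_comp_emb /=.
  by rewrite -[lshift _ _]/(unsplit (inl c)) unsplitK.
- move=> n m; apply: funext => c; rewrite [LHS]Kl_comp_emb /=.
  by rewrite -[rshift _ _]/(unsplit (inr c)) unsplitK.
- move=> n m; apply: funext => c; rewrite [LHS]Kl_comp_emb Kl_zeroE /=.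
  by rewrite -[rshift _ _]/(unsplit (inr c)) unsplitK.
- move=> n m; apply: funext => c; rewrite [LHS]Kl_comp_emb Kl_zeroE /=.
  by rewrite -[lshift _ _]/(unsplit (inl c)) unsplitK.
Qed.

Lemma Kl_is_SMBLaw : is_SMBLaw K.
Proof.
split; [exact: Kl_lawvere | exact: Kl_symmonoidal | exact: Kl_emb_strict |].
exact: Kl_biproduct.
Qed.

Definition KlLaw : SMBLaw_ob := SMBLawOb Kl_is_SMBLaw.

Lemma Kl_prE n (k j : 'I_n) : (pr KlLaw j : Hom K n 1) k = ldelta KlLaw k j ord0.
Proof. by rewrite -pr_pt [RHS]Kl_comp_emb. Qed.

Lemma Kl_entE n m (g : Hom K n m) i j :
  (@ent KlLaw n m g i j : Hom K 1 1) ord0 = bind (g i) (pr KlLaw j : Hom K m 1).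
Proof. by rewrite [LHS]Kl_comp_emb. Qed.

(** Identifies the matrix [theta] with the abstract entries, along the bijection between ['I_1] and
    [unit]. *)
Lemma theta_ent n m (g : Hom K n m) i j :
  theta g i j = mmap T (fun=> tt) ((@ent KlLaw n m g i j : Hom K 1 1) ord0).
Proof.
rewrite Kl_entE map_bind //; apply: eq_bind => k; rewrite Kl_prE /ldelta.
case: eqP => _; first by rewrite /= map_eta.
rewrite Kl_zeroE /zmap.
have /= <- := mmap_comp TP (fun=> tt) (of_void 'I_1) (iso0 T tt).
by congr mmap; apply: funext; case.
Qed.

Lemma theta_inj n m (g h : Hom K n m) :
  (forall i j, theta g i j = theta h i j) -> g = h.
Proof.
move=> e; apply: (@ent_inj KlLaw) => i j; apply: funext => a; rewrite ord1.
have tK (t : T 'I_1) : mmap T (fun=> ord0) (mmap T (fun=> tt) t) = t.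
  have /= <- := mmap_comp TP (fun=> ord0) (fun=> tt) t.
  rewrite -[RHS](mmap_id TP); congr mmap.
  by apply: funext => b /=; rewrite ord1.
by rewrite -[LHS]tK -[RHS]tK -!theta_ent e.
Qed.

End KleisliBiproduct.

Section KleisliMap.
Variables (T T' : ACMnd_ob) (s : forall X : Sets, T X -> T' X).
Hypothesis sP : is_monad_map T T' s.

Lemma mm_bind (X Y : Sets) (t : T X) (f : X -> T Y) :
  s (bind T t f) = bind T' (s t) (fun x => s (f x)).
Proof.
have /= -> := mm_mu sP (mmap T f t).
have /= -> := mm_nat sP f t.
by rewrite -/(bind _ _ _) bind_map //; apply: acm_monad (acmP T').
Qed.

Definition Klmap n m (f : Hom (KlLaw T) n m) : Hom (KlLaw T') n m :=
  fun c => s (f c).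

Lemma Klmap_smb_map : is_smb_map Klmap.
Proof.
apply: is_smb_map_emb.
- by move=> n m k g f; apply: funext => c; apply: mm_bind.
- by move=> n m f; apply: funext => c; apply: (mm_eta sP).
Qed.

End KleisliMap.

(** * The dagger of the Kleisli theory *)

Section KleisliDagger.
Variable S : IACMnd_ob.
Local Notation K := (KlLaw S).

Definition Kl_conj (x : Hom K 1 1) : Hom K 1 1 := fun c => zeta (x c).

(** As [zeta] is a monad map, postcomposition with it is an endomorphism of the theory; the semiring
    laws of [Kl_conj] are its restriction to scalars. *)
Let zmap_smb := Klmap_smb_map (inv_map (zetaP S)).

Lemma Kl_conj1 : Kl_conj (lid 1) = lid 1.
Proof. exact: (sm_id zmap_smb). Qed.

Lemma Kl_conj0 : Kl_conj (lzero 1 1) = lzero 1 1.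
Proof. exact: (smb_map_zero zmap_smb). Qed.

Lemma Kl_conjD x y : Kl_conj (ladd x y) = ladd (Kl_conj x) (Kl_conj y).
Proof. exact: (smb_map_add zmap_smb). Qed.

Lemma Kl_conjM x y : Kl_conj (x \oL y) = Kl_conj x \oL Kl_conj y.
Proof. exact: (sm_comp zmap_smb). Qed.

Lemma Kl_conjK : involutive Kl_conj.
Proof. by move=> x; apply: funext => c; apply: (invK (zetaP S)). Qed.

Lemma theta_trmapent n m (g : Hom K n m) i j :
  theta (trmapent Kl_conj g : Hom K m n) j i = zeta (theta g i j).
Proof.
rewrite !theta_ent ent_trmapent.
pose x : Kl_hom S 1 1 := ent g i j.
by have /= -> := mm_nat (inv_map (zetaP S)) (fun=> tt) (x ord0).
Qed.

(** [theta_trmapent] provides a morphism with the defining property of [Kl_dag], and [theta_inj]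
    makes it unique. *)
Lemma Kl_dagE n m (g : Hom K n m) : Kl_dag g = trmapent Kl_conj g.
Proof.
rewrite /Kl_dag; case: xgetP => [h _ hP|/(_ (trmapent Kl_conj g))[]].
  by apply: (@theta_inj S) => j i; rewrite hP theta_trmapent.
by move=> i j; rewrite theta_trmapent.
Qed.

Lemma Kl_dagger : @is_dagger (Kl_smb S) (@Kl_dag S).
Proof.
have -> : @Kl_dag S = @trmapent K Kl_conj.
  apply: functional_extensionality_dep => n.
  apply: functional_extensionality_dep => m.
  by apply: funext => g; apply: Kl_dagE.
exact: (trmapent_dagger Kl_conj1 Kl_conj0 Kl_conjD Kl_conjM Kl_conjK).
Qed.

End KleisliDagger.

(** * The adjunction *)

Section TLFunctor.
Variables (L L' : SMBLaw_ob) (F : forall n m, Hom L n m -> Hom L' n m).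
Hypothesis FP : is_smb_map F.

Definition TLfun (X : Sets) : TL L X -> TL L' X :=
  TLlift (fun i g v => cls (F g) v).

Lemma TLfun_cls X i (g : Hom L 1 i) (v : 'I_i -> X) :
  TLfun (cls g v) = cls (F g) v.
Proof.
by rewrite /TLfun TLlift_cls // => *; rewrite (sm_comp FP) (smb_map_emb FP) cls_emb.
Qed.

Lemma TLfun_monad_map : is_monad_map (TLops L) (TLops L') TLfun.
Proof.
split=> X.
- move=> Y f t; case: (cls_surj t) => i [g [v ->]].
  by rewrite /= TLmap_cls !TLfun_cls TLmap_cls.
- by move=> x; rewrite /= /TLeta TLfun_cls (sm_id FP).
- move=> t; case: (cls_cls_surj t) => i [g [j [g_ [v_ ->]]]] /=.
  have [_ _ muE] := TLops_TL L; have [_ _ muE'] := TLops_TL L'.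
  rewrite [TLmu _]muE !TLfun_cls TLmap_cls (sm_comp FP) (smb_map_summap FP).
  rewrite -[RHS]/(mmu (TLops L') _) -muE'; congr (mmu _ (cls _ _)).
  by apply: funext => a; rewrite /= TLfun_cls.
Qed.

End TLFunctor.

Definition TLob (L : SMBLaw_ob) : ACMnd_ob := ACMndOb (TLops_ACMnd L).

Definition TLhom (L L' : SMBLaw_ob) (F : SMBLaw_hom L L') :
    ACMnd_hom (TLob L) (TLob L') :=
  exist _ _ (TLfun_monad_map (svalP F)).

(** * The involution on T_L induced by a dagger *)

Section Dagger.
Variable L : DSMBLaw_ob.
Let BP := smb_biprod (smbP L).
Let LP := smb_lawvere (smbP L).
Let DP := dagP L.
Local Notation dag := (@dag L _ _).

Lemma dag0 n m : dag (lzero n m) = lzero m n.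
Proof.
rewrite /lzero (dag_comp DP).
by congr lcomp; [apply: linitP | apply: ltermP].
Qed.

Lemma dag_pair n m k (f : Hom L k n) (g : Hom L k m) :
  dag (pair f g) = copair (dag f) (dag g).
Proof.
apply: (copair_eq LP).
  by rewrite copair1 // (dag_pi1 DP) -(dag_comp DP) pair1.
by rewrite copair2 // (dag_pi2 DP) -(dag_comp DP) pair2.
Qed.

Lemma dag_copair n m k (f : Hom L n k) (g : Hom L m k) :
  dag (copair f g) = pair (dag f) (dag g).
Proof. by rewrite -[RHS](dagK DP) dag_pair !(dagK DP). Qed.

Lemma dagD n m (f g : Hom L n m) : dag (ladd f g) = ladd (dag f) (dag g).
Proof.
rewrite /ladd (dag_comp DP) dag_pair dag_copair !(dag_id DP) copair_pair.
by rewrite !(lcomp1 LP).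
Qed.

Lemma dag_scalarM (x y : Hom L 1 1) : dag (x \oL y) = dag x \oL dag y.
Proof. by rewrite (dag_comp DP) scalarC. Qed.

Lemma dag_pr n (j : 'I_n) : dag (pr L j) = pt L j.
Proof.
elim: n j => [|n IHn] j; first by case: j.
case: (unliftP ord0 j) => [a ->|->].
  rewrite pr_lift (dag_comp DP) IHn pt_lift //; congr lcomp.
  exact: (esym (dag_pi2 DP 1 n)).
by rewrite pr_ord0 pt_ord0; apply: (esym (dag_pi1 DP 1 n)).
Qed.

(** A dagger reverses composition and exchanges points with projections, so it transposes the matrix
    and acts on each entry. *)
Lemma dag_trmapent n m (f : Hom L n m) : dag f = trmapent (@Defs.dag L 1 1) f.
Proof.
apply: ent_inj => j i; rewrite ent_trmapent /ent !(dag_comp DP) dag_pr.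
by rewrite -{1}(dagK DP (pr L i)) dag_pr (lcompA LP).
Qed.

Definition dconj n m : Hom L n m -> Hom L n m :=
  @mapent L (@Defs.dag L 1 1) n m.

(** The dagger without its transposition is covariant: on scalars it preserves products because
    scalars commute. *)
Lemma dconj_smb_map : is_smb_map dconj.
Proof.
apply: is_smb_map_emb.
  by move=> *; apply: mapent_comp; [apply: dag0|apply: dagD|apply: dag_scalarM].
by move=> *; apply: mapent_emb; [apply: dag_id|apply: dag0].
Qed.

Lemma dconjK n m : involutive (@dconj n m).
Proof. by move=> f; apply: mapentK; apply: dagK. Qed.

Definition TLzeta := TLfun dconj.

Lemma TLzeta_cls X i (g : Hom L 1 i) (v : 'I_i -> X) :
  TLzeta (cls g v) = cls (dconj g) v.
Proof. exact: (TLfun_cls dconj_smb_map). Qed.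

Lemma TLzeta_TL : is_TL_zeta TLzeta.
Proof.
move=> X i g v; rewrite TLzeta_cls; congr cls.
apply: ent_inj => a b; rewrite ent_mapent !ord1 !ent_scalarr.
by rewrite !pr_tuple.
Qed.

Lemma TLzeta_involution : @is_involution (TLob L) TLzeta.
Proof.
split; first exact: TLfun_monad_map dconj_smb_map.
move=> X t; case: (cls_surj t) => i [g [v ->]].
by rewrite !TLzeta_cls dconjK.
Qed.

Definition TLDob : IACMnd_ob := IACMndOb TLzeta_involution.

End Dagger.

Section EntrywiseMap.
Variables (L L' : SMBLaw_ob) (F : forall n m, Hom L n m -> Hom L' n m).
Hypothesis FP : is_smb_map F.
Variables (z : Hom L 1 1 -> Hom L 1 1) (z' : Hom L' 1 1 -> Hom L' 1 1).
Hypothesis Fz : forall x, F (z x) = z' (F x).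

Lemma smb_map_ent n m (f : Hom L n m) i j : F (ent f i j) = ent (F f) i j.
Proof. by rewrite /ent !(sm_comp FP) (smb_map_pr FP) (smb_map_pt FP). Qed.

Lemma smb_map_mapent n m (f : Hom L n m) : F (mapent z f) = mapent z' (F f).
Proof.
by apply: ent_inj => i j; rewrite -smb_map_ent !ent_mapent Fz smb_map_ent.
Qed.

Lemma smb_map_trmapent n m (f : Hom L n m) : F (trmapent z f) = trmapent z' (F f).
Proof.
by apply: ent_inj => i j; rewrite -smb_map_ent !ent_trmapent Fz smb_map_ent.
Qed.

End EntrywiseMap.

Definition KlDob (S : IACMnd_ob) : DSMBLaw_ob :=
  @DSMBLawOb (KlLaw S) (@Kl_dag S) (Kl_dagger S).

Lemma dsmb_hom_dconj (L L' : DSMBLaw_ob) (F : DSMBLaw_hom L L') n m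
    (f : Hom L n m) : sval (sval F) n m (dconj f) = dconj (sval (sval F) n m f).
Proof. by apply: smb_map_mapent; [apply: (svalP (sval F))|apply: (svalP F)]. Qed.

Lemma TLD_subproof (L L' : DSMBLaw_ob) (F : DSMBLaw_hom L L') (X : Sets) :
  sval (TLhom (sval F)) X \o @zeta (TLDob L) X =1
  @zeta (TLDob L') X \o sval (TLhom (sval F)) X.
Proof.
move=> t; case: (cls_surj t) => i [g [v ->]] /=.
have FP := svalP (sval F).
rewrite (TLfun_cls FP) !TLzeta_cls (TLfun_cls FP).
by rewrite dsmb_hom_dconj.
Qed.

Definition TLDhom (L L' : DSMBLaw_ob) (F : DSMBLaw_hom L L') :
    IACMnd_hom (TLDob L) (TLDob L') := exist _ _ (TLD_subproof F).

Lemma Klmap_dag (S S' : IACMnd_ob) (s : IACMnd_hom S S') n m (f : Kl_hom S n m) :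
  Klmap (sval (sval s)) (Kl_dag f : Hom (KlLaw S) m n) =
  (Kl_dag (Klmap (sval (sval s)) (f : Hom (KlLaw S) n m)) : Kl_hom S' m n).
Proof.
rewrite !Kl_dagE; apply: (smb_map_trmapent (Klmap_smb_map (svalP (sval s)))).
by move=> x; apply: funext => c; apply: (svalP s).
Qed.

Definition KlDhom (S S' : IACMnd_ob) (s : IACMnd_hom S S') :
    DSMBLaw_hom (KlDob S) (KlDob S') :=
  exist (fun F : SMBLaw_hom (KlDob S) (KlDob S') => _)
    (exist (fun F => is_smb_map F) _ (Klmap_smb_map (svalP (sval s))))
    (@Klmap_dag _ _ s).

(** * The unit of the adjunction *)

Section Unit.
Variable L : SMBLaw_ob.
Let LP := smb_lawvere (smbP L).

Definition TLunit n m (g : Hom L n m) : Hom (KlLaw (TLob L)) n m :=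
  fun c => cls (g \oL pt L c) id.

Lemma TLunit_smb_map : is_smb_map TLunit.
Proof.
apply: is_smb_map_emb.
  move=> n m k g f; apply: funext => c; apply: ext_inj => l q.
  rewrite -[RHS]/(ext (TLmu (TLmap (TLunit g) (TLunit f c))) q).
  rewrite ext_mu ext_map /TLunit !ext_cls -(lcompA LP) (lcompA LP (cotuple _)).
  congr lcomp; rewrite -[LHS](cotupleE LP); congr cotuple; apply: funext => a.
  by rewrite /= ext_cls (lcompA LP).
move=> n m f; apply: funext => c; rewrite /TLunit emb_pt //.
by rewrite /pt -(lcomp1 LP (emb _)) cls_emb.
Qed.

End Unit.

(** Both daggers are transposes with an entrywise involution, so it suffices to compare them on
    scalars, where [TLzeta] applies the dagger of [L]. *)
Lemma TLunit_dag (L : DSMBLaw_ob) n m (g : Hom L n m) :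
  TLunit (dag g) = Kl_dag (TLunit g : Kl_hom (TLDob L) n m).
Proof.
have LP := smb_lawvere (smbP L).
rewrite Kl_dagE dag_trmapent; apply: (smb_map_trmapent (TLunit_smb_map L)).
move=> x; apply: funext => c.
rewrite -[RHS]/(TLzeta _) TLzeta_cls; congr cls.
by rewrite ord1 (pt1 LP) !(lcomp1 LP) /dconj mapent_scalar.
Qed.

Definition TLunit_hom (L : DSMBLaw_ob) : DSMBLaw_hom L (KlDob (TLDob L)) :=
  exist (fun F : SMBLaw_hom L (KlDob (TLDob L)) => _)
    (exist (fun F => is_smb_map F) _ (TLunit_smb_map L)) (@TLunit_dag L).

(** * Transposes of maps into a Kleisli theory *)

Section Transpose.
Variables (L : DSMBLaw_ob) (S : IACMnd_ob) (F : DSMBLaw_hom L (KlDob S)).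
Let LP := smb_lawvere (smbP L).
Let SP := acm_monad (acmP S).
Let FP := svalP (sval F).
Local Notation F' g := (sval (sval F) _ _ g : Kl_hom S _ _).

Definition transpose (X : Sets) : TL L X -> S X :=
  TLlift (fun i g v => mmap S v (F' g ord0)).

Lemma hom_emb_comp n m k (f : 'I_m -> 'I_k) (g : Hom L n m) c :
  F' (emb f \oL g) c = mmap S f (F' g c).
Proof. by rewrite (sm_comp FP) (smb_map_emb FP) [RHS]mmapE. Qed.

Lemma transpose_cls X i (g : Hom L 1 i) (v : 'I_i -> X) :
  transpose (cls g v) = mmap S v (F' g ord0).
Proof.
rewrite /transpose TLlift_cls // => {}i m f {}g {}v.
by rewrite hom_emb_comp; have /= <- := mmap_comp SP v f (F' g ord0).
Qed.

Lemma transpose_monad_map : is_monad_map (TLob L) S transpose.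
Proof.
split=> X.
- move=> Y f t; case: (cls_surj t) => i [g [v ->]].
  rewrite /= TLmap_cls !transpose_cls.
  by have /= <- := mmap_comp SP f v (F' g ord0).
- by move=> x; rewrite /= /TLeta transpose_cls (sm_id FP) map_eta.
- move=> t; case: (cls_cls_surj t) => i [g [j [g_ [v_ ->]]]] /=.
  have [_ _ muE] := TLops_TL L; rewrite [TLmu _]muE !transpose_cls.
  rewrite (sm_comp FP) -[in LHS]/(bind S (F' g ord0) (F' (summap g_))) map_bind //.
  have /= <- := mmap_comp SP (@transpose X) (fun a => cls (g_ a) (v_ a)) (F' g ord0).
  apply: eq_bind => a /=; rewrite transpose_cls.
  (* Since [F] preserves points, the value at [a] is found by restricting to the a-th summand, where
     the sum is [g_ a] followed by the renaming [tagnat.Rank]. *)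
  have -> : F' (summap g_) a = F' (summap g_ \oL pt L a) ord0.
    by rewrite (sm_comp FP) (smb_map_pt FP) [RHS]bind_eta.
  rewrite /summap cotuple_pt // hom_emb_comp.
  have /= <- := mmap_comp SP (fun c => v_ (tagnat.sig1 c) (tagnat.sig2 c))
                  (@tagnat.Rank i j a) (F' (g_ a) ord0).
  by congr mmap; apply: funext => b; rewrite /= sig_Rank.
Qed.

Lemma transpose_zeta X (t : TL L X) : transpose (TLzeta t) = zeta (transpose t).
Proof.
case: (cls_surj t) => i [g [v ->]].
rewrite TLzeta_cls !transpose_cls.
have zS := Klmap_smb_map (inv_map (zetaP S)).
(* On scalars this is preservation of the dagger, as transposing a 1 by 1 matrix does nothing; it
   extends entrywise because postcomposition with [zeta] commutes with taking entries. *)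
have -> : F' (dconj g) = fun c => zeta (F' g c).
  rewrite /dconj (smb_map_mapent FP (z' := @Kl_conj S)); last first.
    move=> x; rewrite [LHS](svalP F) [LHS]Kl_dagE; apply: trmapent_scalar.
  by apply: (@ent_inj (KlLaw S)) => a b; rewrite ent_mapent -(smb_map_ent zS).
by have /= -> := mm_nat (inv_map (zetaP S)) v (F' g ord0).
Qed.

Definition transpose_hom : IACMnd_hom (TLDob L) S :=
  exist (fun s : ACMnd_hom (TLDob L) S => _)
    (exist (fun s => is_monad_map (TLob L) S s) _ transpose_monad_map)
    transpose_zeta.

End Transpose.

Theorem lemma33 :
  exists (M : forall L : SMBLaw, monad_ops (TL L))
         (M_acm : forall L : SMBLaw, is_ACMnd (M L))
         (T : @functor SMBLaw ACMnd (fun L => ACMndOb (M_acm L)))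
         (z : forall (L : DSMBLaw) (X : Sets), TL L X -> TL L X)
         (z_inv : forall L : DSMBLaw,
            @is_involution (ACMndOb (M_acm L)) (z L))
         (TD : @functor DSMBLaw IACMnd (fun L => IACMndOb (z_inv L)))
         (Kl_smbP : forall S : IACMnd, is_SMBLaw (Kl_smb S))
         (Kl_dagP : forall S : IACMnd, @is_dagger (Kl_smb S) (@Kl_dag S))
         (Kl : @functor IACMnd DSMBLaw
            (fun S => @DSMBLawOb (SMBLawOb (Kl_smbP S)) (@Kl_dag S)
                                 (Kl_dagP S))),
    (* T is the functor L |-> T_L on SMBLaw *)
    (forall L : SMBLaw, is_TL_ops (M L)) /\
    (forall (L L' : SMBLaw) (F : hom L L') (X : Sets) (i : nat)
       (g : Hom L 1 i) (v : 'I_i -> X),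
       sval (fmap T F) X (cls g v) = cls (sval F 1 i g) v) /\
    (* TD is the restriction of T to DSMBLaw *)
    (forall L : DSMBLaw, is_TL_zeta (z L)) /\
    (forall (L L' : DSMBLaw) (F : hom L L'),
       sval (fmap TD F) = fmap T (sval F)) /\
    (* Kl acts on monad maps by postcomposition *)
    (forall (S S' : IACMnd) (s : hom S S') (n m : nat) (f : Kl_hom S n m),
       sval (sval (fmap Kl s)) n m f = sval (sval s) 'I_m \o f) /\
    left_adjoint TD Kl.
Proof.
have T1 (L : SMBLaw) : TLhom (SMBLaw_id L) = ACMnd_id (TLob L).
  apply: ACMnd_homP => X t; case: (cls_surj t) => i [g [v ->]].
  exact: (TLfun_cls (svalP (SMBLaw_id L))).
have TM (L1 L2 L3 : SMBLaw) (G : SMBLaw_hom L2 L3) (F : SMBLaw_hom L1 L2) :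
    TLhom (SMBLaw_comp G F) = ACMnd_comp (TLhom G) (TLhom F).
  apply: ACMnd_homP => X t; case: (cls_surj t) => i [g [v ->]] /=.
  rewrite (TLfun_cls (svalP F)) (TLfun_cls (svalP G)).
  exact: (TLfun_cls (svalP (SMBLaw_comp G F))).
pose T := @Functor SMBLaw ACMnd TLob TLhom T1 TM.
have TD1 (L : DSMBLaw) : TLDhom (DSMBLaw_id L) = IACMnd_id (TLDob L).
  by apply: sval_eq; apply: T1.
have TDM (L1 L2 L3 : DSMBLaw) (G : DSMBLaw_hom L2 L3) (F : DSMBLaw_hom L1 L2) :
    TLDhom (DSMBLaw_comp G F) = IACMnd_comp (TLDhom G) (TLDhom F).
  by apply: sval_eq; apply: TM.
pose TD := @Functor DSMBLaw IACMnd TLDob TLDhom TD1 TDM.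
have K1 (S : IACMnd) : KlDhom (IACMnd_id S) = DSMBLaw_id (KlDob S).
  by do 2 apply: sval_eq.
have KM (S1 S2 S3 : IACMnd) (s : IACMnd_hom S2 S3) (r : IACMnd_hom S1 S2) :
    KlDhom (IACMnd_comp s r) = DSMBLaw_comp (KlDhom s) (KlDhom r).
  by do 2 apply: sval_eq.
pose Kl := @Functor IACMnd DSMBLaw KlDob KlDhom K1 KM.
exists TLops, TLops_ACMnd, T, TLzeta, TLzeta_involution, TD.
exists (fun S : IACMnd_ob => Kl_is_SMBLaw S), Kl_dagger, Kl.
split; first exact: TLops_TL.
split; first by move=> L L' F X i g v; apply: (TLfun_cls (svalP F)).
split; first exact: TLzeta_TL.
split=> //; split=> //.
(* The hom-set bijection applies the Kleisli functor and precomposes with the unit; its inverse is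
   [transpose_hom]. *)
exists (fun L S s => DSMBLaw_comp (KlDhom s) (TLunit_hom L)); split.
- move=> L S; exists (@transpose_hom L S) => [s|F].
    do 2 apply: sval_eq.
    apply: functional_extensionality_dep => X; apply: funext => t /=.
    case: (cls_surj t) => i [g [v ->]]; rewrite transpose_cls /=.
    have /= <- := mm_nat (svalP (sval s)) v (cls (g \oL pt L ord0) id).
    have LP := smb_lawvere (smbP L).
    by rewrite TLmap_cls (pt1 LP) (lcomp1 LP).
  (* Other composite: the unit yields the class of [g \oL pt L c] with identity variables, whose
     transpose is the value of [F] on [g] at [c]. *)
  do 2 apply: sval_eq.
  apply: functional_extensionality_dep => n.
  apply: functional_extensionality_dep => m.
  apply: funext => g; apply: funext => c /=.
  have FP := svalP (sval F).
  rewrite /Klmap /TLunit transpose_cls (mmap_id (acm_monad (acmP S))) /=.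
  by rewrite (sm_comp FP) (smb_map_pt FP) [LHS]Kl_comp_emb.
- move=> L L' S h s; do 2 apply: sval_eq.
  apply: functional_extensionality_dep => n.
  apply: functional_extensionality_dep => m.
  apply: funext => g; apply: funext => c /=.
  have hP := svalP (sval h).
  by rewrite /Klmap /TLunit /= (TLfun_cls hP) (sm_comp hP) (smb_map_pt hP).
- by move=> L S S' k s; do 2 apply: sval_eq.
Qed.
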